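(* Let $1\le n\le N$ and let $P\subset\mathbb{R}^N$ be an $n$-polyhedron. If $\alpha P$ and $\beta P$ are triangulations of $P$, then $\alpha P\sim\beta P$, i.e. $\alpha P$ can be transformed into $\beta P$ by finitely many elementary moves.
   Context: A polytope is the compact convex hull of finitely many points in $\mathbb{R}^N$. For $1\le n\le N$, an $n$-polyhedron in $\mathbb{R}^N$ is a finite union of $n$-dimensional polytopes. An $n$-simplex is an $n$-dimensional simplex in $\mathbb{R}^N$ (the convex hull of $n+1$ affinely independent points). A triangulation $\alpha P$ of an $n$-polyhedron $P$ is a finite set of $n$-simplices such that no pair of (distinct) simplices intersects in a set of dimension $n$ and the union of the simplices equals $P$. (It is not required that two simplices intersect in a common face.) An elementary move applied to a triangulation $\alpha P$ is one of the following two operations: (i) a simplex $T\in\alpha P$ is dissected into two $n$-simplices $T_1,T_2$ by a hyperplane containing an $(n-2)$-dimensional face of $T$ (for $n=1$ this face is the empty face), so that $T$ is replaced by $T_1,T_2$; or (ii) the reverse: two simplices $T_1,T_2\in\alpha P$ are replaced by $T=T_1\cup T_2$ if $T$ is again a simplex. Triangulations $\alpha P$ and $\beta P$ are equivalent by elementary moves, written $\alpha P\sim\beta P$, if there are finitely many elementary moves that transform $\alpha P$ into $\beta P$. *)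

(* Defs.v *)
From Stdlib Require Import Relation_Operators.
From mathcomp Require Import all_boot all_order all_algebra.
From mathcomp Require Import all_classical reals.

Set Implicit Arguments.
Unset Strict Implicit.
Unset Printing Implicit Defensive.

Import Order.TTheory GRing.Theory Num.Theory.

Local Open Scope classical_set_scope.
Local Open Scope ring_scope.

(* R^N is the space of row vectors 'rV[R]_N over R : realType. *)
Section Polyhedra.
Context {R : realType} {N : nat}.
Notation point := 'rV[R]_N.
Implicit Types (A S T F P : set point) (a b : set (set point)).

Definition affine_hull A : set point :=
  [set x | exists (k : nat) (p : 'I_k -> point) (w : 'I_k -> R),
    [/\ forall i, A (p i), \sum_i w i = 1 & x = \sum_i w i *: p i]].

Definition convex_hull A : set point :=
  [set x | exists (k : nat) (p : 'I_k -> point) (w : 'I_k -> R),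
    [/\ forall i, A (p i), forall i, 0 <= w i, \sum_i w i = 1
      & x = \sum_i w i *: p i]].

(* The dimension of a set is that of its affine hull; the empty set has no
   dimension d : nat. *)
Definition has_dim (d : nat) S : Prop :=
  exists (x0 : point) (U : {vspace point}),
    \dim U = d /\ affine_hull S = [set x | x - x0 \in U].

Definition polytope P : Prop :=
  exists A, finite_set A /\ P = convex_hull A.

(* The empty union is allowed. *)
Definition polyhedron (n : nat) P : Prop :=
  exists Q : set (set point),
    [/\ finite_set Q, forall S, Q S -> polytope S /\ has_dim n S
      & P = \bigcup_(S in Q) S].

Definition affinely_independent (k : nat) (p : 'I_k -> point) : Prop :=
  forall w : 'I_k -> R,
    \sum_i w i = 0 -> \sum_i w i *: p i = 0 -> forall i, w i = 0.

Definition simplex_on (n : nat) (p : 'I_n.+1 -> point) T : Prop :=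
  affinely_independent p /\ T = convex_hull (range p).

Definition simplex (n : nat) T : Prop :=
  exists p : 'I_n.+1 -> point, simplex_on p T.

(* F is the face of the n-simplex T spanned by m of its vertices, so that F has
   dimension m - 1; m = 0 gives the empty face. *)
Definition simplex_face (n m : nat) T F : Prop :=
  exists (p : 'I_n.+1 -> point) (J : {set 'I_n.+1}),
    [/\ simplex_on p T, #|J| = m & F = convex_hull (p @` [set` J])].

Definition triangulation (n : nat) P a : Prop :=
  [/\ finite_set a,
      forall T, a T -> simplex n T,
      forall T1 T2, a T1 -> a T2 -> T1 <> T2 -> ~ has_dim n (T1 `&` T2)
    & \bigcup_(T in a) T = P].

Definition dot (u x : point) : R := \sum_i u ord0 i * x ord0 i.

Definition hyperplane (u : point) (c : R) : set point := [set x | dot u x = c].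

(* An (n-2)-dimensional face has n.-1 vertices. When n < N a hyperplane of R^N
   may contain T, in which case it does not dissect T. *)
Definition dissection (n : nat) T T1 T2 : Prop :=
  exists (u : point) (c : R),
    [/\ u != 0,
        ~ (T `<=` hyperplane u c),
        exists F, simplex_face n n.-1 T F /\ F `<=` hyperplane u c,
        T1 = T `&` [set x | dot u x <= c] /\ T2 = T `&` [set x | c <= dot u x]
      & simplex n T1 /\ simplex n T2].

Definition split_move (n : nat) a b : Prop :=
  exists T T1 T2,
    [/\ a T, dissection n T T1 T2 & b = (a `\ T) `|` [set T1; T2]].

Definition merge_move (n : nat) a b : Prop :=
  exists T1 T2,
    [/\ a T1, a T2, T1 <> T2, simplex n (T1 `|` T2)
      & b = (a `\` [set T1; T2]) `|` [set T1 `|` T2]].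

Definition elementary_move (n : nat) P a b : Prop :=
  triangulation n P a /\ (split_move n a b \/ merge_move n a b).

Definition move_equivalent (n : nat) P : set (set point) -> set (set point) -> Prop :=
  clos_refl_trans _ (elementary_move n P).

End Polyhedra.

(* Main.v *)
Require Import Defs.
From Stdlib Require Import Relation_Operators.
From HB Require Import structures.
From mathcomp Require Import all_boot all_order all_algebra.
From mathcomp Require Import all_classical reals.
From mathcomp Require Import zify ring lra.

(* Simplices are handled through the simplicial cones over the points (x, 1), and
   equivalence by moves through the relation eqv on lists of simplices.

   The heart is the case where the family l tiles a single n-simplex s, proved by
   induction on n.  Let e be the direction of an edge of s.  Splitting edges turns
   every member of l into columns: simplices with an edge parallel to e, that is
   regions between the graphs of two affine functions, differing at one vertex only,
   over an (n-1)-simplex, the base.  Now s itself is a column.  Cut its base along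
   the facets of all bases and the zero sets of all differences of height functions.
   The pieces g inside the base of a column K tile that base, so by induction they
   are equivalent to it, and this equivalence lifts to K: hence K is equivalent to
   the union of its slabs over these g.  Over a fixed g the slabs of all columns of l
   are stacked from the bottom to the top of s, so together they are equivalent to the
   slab of s over g, and these make up s.

   For two triangulations of P, cut the second along hyperplanes until each piece
   lies in a simplex of the first; the pieces inside a given simplex tile it. *)

Set Implicit Arguments.
Unset Strict Implicit.
Unset Printing Implicit Defensive.

Import Order.TTheory GRing.Theory Num.Theory.

Local Open Scope ring_scope.

(** Splitting is never the difficulty: faces need not match, so the members of a family can be cut
    independently of each other. The difficulty is merging back, since the pieces left by arbitrary
    cuts offer no evident sequence of merges. This is why two families are compared through tilings
    of one simplex, and why that case needs an induction. Columns make the dimension drop. A slab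
    over a base simplex has one staircase triangulation for each order of the vertices, and a split
    of a base edge lifts directly when the ends of that edge are raised last. So the order must be
    changeable: two orders that differ by an adjacent swap differ by a flip in a planar trapezoid,
    which moves can realise. With the order free, splits of the base lift and slabs can be stacked.
    Passing from x to (x, 1) turns affine independence into linear independence, simplices into
    cones given by generators, and full-dimensional overlap into a free family of full size lying in
    both cones. *)

Ltac count_lia :=
  repeat match goal with
  | |- context [nat_of_bool ?b] => generalize (nat_of_bool b); intro
  | |- context [@count ?T ?p ?s] => generalize (@count T p s); intro
  end; clear; lia.

(** Counting an arbitrary predicate on both sides turns a permutation of explicit lists into linear
    arithmetic over the naturals. *)
Ltac solve_perm := apply/permP => ?; rewrite /=; do ?rewrite count_cat /=; count_lia.

Section Coordinates.
Context {R : realFieldType} {W : vectType R}.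
Implicit Types x y : W.

(** Coordinates in a fixed basis of the whole space let [vector_field] check vector identities with
    quotients as scalar identities. *)
Definition crd i x : R := coord (vbasis (fullv : {vspace W})) i x.

Lemma crdP x y : (forall i, crd i x = crd i y) -> x = y.
Proof.
move=> E; rewrite (coord_vbasis (memvf x)) (coord_vbasis (memvf y)).
by apply: eq_bigr => i _; congr (_ *: _); apply: E.
Qed.

Lemma crdD i x y : crd i (x + y) = crd i x + crd i y.
Proof. by rewrite /crd linearD. Qed.

Lemma crdN i x : crd i (- x) = - crd i x.
Proof. by rewrite /crd linearN. Qed.

Lemma crdZ i (a : R) x : crd i (a *: x) = a * crd i x.
Proof. by rewrite /crd linearZ. Qed.

End Coordinates.

Ltac vector_field := apply: crdP => ?; rewrite !(crdD, crdN, crdZ); field.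

(** * Equivalence of families of simplices *)

Section Equivalence.
Context {R : realFieldType} {W : vectType R}.
Notation dual := 'Hom(W, R^o).
Implicit Types (s g pre G r : seq W) (l : seq (seq W)) (f h k : dual).
Implicit Types (u v w x y z : W) (t : R) (m : nat) (fs : seq dual).
Implicit Types K : seq W.

Definition ev f x : R := f x.

Lemma evD f x y : ev f (x + y) = ev f x + ev f y.
Proof. by rewrite /ev linearD. Qed.

Lemma evB f x y : ev f (x - y) = ev f x - ev f y.
Proof. by rewrite /ev linearB. Qed.

Lemma evZ f (a : R) x : ev f (a *: x) = a * ev f x.
Proof. by rewrite /ev linearZ. Qed.

Lemma ev0 f : ev f 0 = 0.
Proof. by rewrite /ev linear0. Qed.

Lemma ev_sum f (I : Type) (r : seq I) (F : I -> W) :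
  ev f (\sum_(i <- r) F i) = \sum_(i <- r) ev f (F i).
Proof. by rewrite /ev linear_sum. Qed.

Lemma ev_subf f h x : ev (f - h) x = ev f x - ev h x.
Proof. by rewrite /ev add_lfunE opp_lfunE. Qed.

(** In a split, [G] spans the face of codimension 2 through which the cut passes, and [w] is where
    the cut meets the opposite edge; merging is the symmetric case. Freeness and non-overlap are not
    part of the relation: [eqv_tri] transports them along it in both directions. *)
Inductive eqv : seq (seq W) -> seq (seq W) -> Prop :=
| eqv_perm l1 l2 : perm_eq l1 l2 -> eqv l1 l2
| eqv_vertices s1 s2 l : perm_eq s1 s2 -> eqv (s1 :: l) (s2 :: l)
| eqv_split x y w G l t : 0 < t -> t < 1 -> w = (1 - t) *: x + t *: y ->
    eqv ((x :: y :: G) :: l) ((w :: y :: G) :: (x :: w :: G) :: l)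
| eqv_sym l1 l2 : eqv l1 l2 -> eqv l2 l1
| eqv_trans l2 l1 l3 : eqv l1 l2 -> eqv l2 l3 -> eqv l1 l3.

Lemma eqv_refl l : eqv l l.
Proof. exact: eqv_perm. Qed.
Hint Resolve eqv_refl : core.

Lemma eqv_permL l1 l2 l3 : perm_eq l1 l2 -> eqv l2 l3 -> eqv l1 l3.
Proof. by move=> p; apply: eqv_trans; apply: eqv_perm. Qed.

Lemma eqv_permR l1 l2 l3 : perm_eq l3 l2 -> eqv l1 l2 -> eqv l1 l3.
Proof. by move=> p /eqv_trans; apply; apply/eqv_sym/eqv_perm. Qed.

Lemma eqv_catr l1 l2 l : eqv l1 l2 -> eqv (l1 ++ l) (l2 ++ l).
Proof.
elim=> {l1 l2}.
- by move=> l1 l2 p; apply: eqv_perm; rewrite perm_cat2r.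
- by move=> s1 s2 l1 p; apply: eqv_vertices.
- by move=> x y w G l1 t t0 t1 e; apply: (eqv_split _ _ t0 t1 e).
- by move=> l1 l2 _; apply: eqv_sym.
- by move=> l2 l1 l3 _ e1 _; apply: eqv_trans.
Qed.

Lemma eqv_cat l1 l2 l3 l4 : eqv l1 l2 -> eqv l3 l4 -> eqv (l1 ++ l3) (l2 ++ l4).
Proof.
move=> e12 e34; apply: eqv_trans (eqv_catr l3 e12) _.
apply: (@eqv_permL _ (l3 ++ l2)); first by rewrite perm_catC.
by apply: (@eqv_permR _ (l4 ++ l2)); [rewrite perm_catC | apply: eqv_catr].
Qed.

Lemma eqv_cons s1 s2 l1 l2 : perm_eq s1 s2 -> eqv l1 l2 -> eqv (s1 :: l1) (s2 :: l2).
Proof.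
by move=> p e; apply: eqv_trans (eqv_vertices _ p) _; apply: (@eqv_cat [:: s2] [:: s2]).
Qed.

Lemma eqv_flatten (T : eqType) (F1 F2 : T -> seq (seq W)) (r : seq T) :
  (forall i, i \in r -> eqv (F1 i) (F2 i)) ->
  eqv (flatten [seq F1 i | i <- r]) (flatten [seq F2 i | i <- r]).
Proof.
elim: r => [|i r IH] //= H; apply: eqv_cat; first by apply: H; rewrite mem_head.
by apply: IH => j jr; apply: H; rewrite inE jr orbT.
Qed.

Lemma eqv_split1 x y w G t : 0 < t -> t < 1 -> w = (1 - t) *: x + t *: y ->
  eqv [:: x :: y :: G] [:: w :: y :: G; x :: w :: G].
Proof. exact: eqv_split. Qed.

(* The two triangulations of a convex quadrilateral, coned over K: both refine
   to the four triangles around the intersection z of the diagonals. *)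
Lemma eqv_flip (a b c d z : W) K t (u : R) :
    0 < t -> t < 1 -> 0 < u -> u < 1 ->
    z = (1 - t) *: a + t *: d -> z = (1 - u) *: b + u *: c ->
  eqv [:: [:: a, d, c & K]; [:: a, d, b & K]] [:: [:: b, c, a & K]; [:: b, c, d & K]].
Proof.
move=> t0 t1 u0 u1 za zb.
apply: (@eqv_trans ([:: [:: z, d, c & K]; [:: a, z, c & K]] ++
   [:: [:: z, d, b & K]; [:: a, z, b & K]])).
  by apply: (@eqv_cat [:: _] _ [:: _]); apply: eqv_split1 za.
apply: eqv_sym.
apply: (@eqv_trans ([:: [:: z, c, a & K]; [:: b, z, a & K]] ++
   [:: [:: z, c, d & K]; [:: b, z, d & K]])).
  by apply: (@eqv_cat [:: _] _ [:: _]); apply: eqv_split1 zb.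
apply: (@eqv_permL _ [:: [:: z, c, d & K]; [:: z, c, a & K];
   [:: b, z, d & K]; [:: b, z, a & K]]); first by solve_perm.
do 4!(apply: eqv_cons; first by solve_perm).
exact: eqv_refl.
Qed.

(** * Staircase triangulations of the region between two graphs *)

Section Staircase.
Variable e : W.

Definition lift h x := x + ev h x *: e.

Lemma lift_comb h (a b : R) x y : lift h (a *: x + b *: y) = a *: lift h x + b *: lift h y.
Proof. by rewrite /lift evD !evZ; vector_field. Qed.

(* The prism over g between the graphs of h and h' <= h, cut by raising the
   vertices of g one after the other; pre lists the vertices already raised. *)
Fixpoint stair h h' pre g : seq (seq W) :=
  if g is v :: g' then
    (if ev h v < ev h' v then [:: lift h v :: lift h' v :: pre ++ map (lift h) g']
     else [::]) ++ stair h h' (lift h' v :: pre) g'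
  else [::].

Definition below g h h' := forall v, v \in g -> ev h v <= ev h' v.

Lemma below_cons v g h h' :
  below (v :: g) h h' -> (ev h v < ev h' v \/ ev h v = ev h' v) /\ below g h h'.
Proof.
move=> b; split; last by move=> u ug; apply: b; rewrite inE ug orbT.
by have := b v (mem_head _ _); rewrite le_eqVlt => /orP[/eqP|]; [right|left].
Qed.

Lemma below_perm g g' h h' : perm_eq g g' -> below g h h' -> below g' h h'.
Proof. by move=> p b v; rewrite -(perm_mem p); apply: b. Qed.

Lemma lift_eq h h' v : ev h v = ev h' v -> lift h v = lift h' v.
Proof. by rewrite /lift => ->. Qed.

Lemma map_lift_eq h h' g :
  (forall v, v \in g -> ev h v = ev h' v) -> map (lift h) g = map (lift h') g.
Proof. by move=> E; apply/eq_in_map => v vg; apply: lift_eq; apply: E. Qed.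

Lemma stair_pre h h' pre1 pre2 g :
  perm_eq pre1 pre2 -> eqv (stair h h' pre1 g) (stair h h' pre2 g).
Proof.
elim: g pre1 pre2 => [|v g IH] pre1 pre2 p //=.
apply: eqv_cat; last by apply: IH; rewrite perm_cons.
by case: ifP => // _; apply: eqv_cons => //; rewrite !perm_cons perm_cat2r.
Qed.

Lemma stair_eq h1 h1' h2 h2' pre g :
  (forall v, v \in g -> ev h1 v = ev h2 v) -> (forall v, v \in g -> ev h1' v = ev h2' v) ->
  stair h1 h1' pre g = stair h2 h2' pre g.
Proof.
elim: g pre => [|v g IH] //= pre E E'.
have Eg u : u \in g -> ev h1 u = ev h2 u by move=> ug; apply: E; rewrite inE ug orbT.
have Eg' u : u \in g -> ev h1' u = ev h2' u by move=> ug; apply: E'; rewrite inE ug orbT.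
rewrite !(E v, E' v) ?mem_head // (map_lift_eq Eg) (lift_eq (E v _)) ?mem_head //.
by rewrite (lift_eq (E' v _)) ?mem_head // IH.
Qed.

Lemma stair_flat h h' pre g :
  (forall v, v \in g -> ev h v = ev h' v) -> stair h h' pre g = [::].
Proof.
elim: g pre => [|v g IH] //= pre E; rewrite E ?mem_head // ltxx /=.
by apply: IH => u ug; apply: E; rewrite inE ug orbT.
Qed.

(* Raising x then y, or y then x, in a trapezoid with vertical sides. *)
Lemma eqv_raise_swap x y K (a b c d : R) : a < b -> c < d ->
  eqv [:: [:: x + a *: e, x + b *: e, y + c *: e & K];
          [:: y + c *: e, y + d *: e, x + b *: e & K]]
      [:: [:: y + c *: e, y + d *: e, x + a *: e & K];
          [:: x + a *: e, x + b *: e, y + d *: e & K]].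
Proof.
move=> ab cd; have n0 : b - a + (d - c) != 0 by apply/eqP; lra.
have p0 : 0 < b - a + (d - c) by lra.
(* By similar triangles both diagonals of the trapezoid, whose vertical sides have lengths [b - a]
   and [d - c], are divided in this ratio. *)
pose t := (b - a) / (b - a + (d - c)).
have t0 : 0 < t by rewrite divr_gt0 //; lra.
have t1 : t < 1 by rewrite ltr_pdivrMr //; lra.
pose z := (1 - t) *: (x + a *: e) + t *: (y + d *: e).
have zE : z = (1 - t) *: (x + b *: e) + t *: (y + c *: e).
  by rewrite /z /t; vector_field.
apply: eqv_trans _ (eqv_trans (eqv_sym (@eqv_flip _ _ _ _ z K _ _ t0 t1 t0 t1 erefl zE)) _).
  by do 2!(apply: eqv_cons; first by solve_perm).
by do 2!(apply: eqv_cons; first by solve_perm).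
Qed.

(** Only the simplices raising [u] and [v] are affected. If both vertices move, this is the
    trapezoid flip; if at most one moves, the two lists agree up to reordering vertices. *)
Lemma stair_swap h h' pre u v g : below [:: u, v & g] h h' ->
  eqv (stair h h' pre [:: u, v & g]) (stair h h' pre [:: v, u & g]).
Proof.
move=> /below_cons[hu /below_cons[hv _]] /=; rewrite !catA.
apply: eqv_cat; last by apply: stair_pre; solve_perm.
case: hu => hu; case: hv => hv; rewrite ?hu ?hv ?ltxx //=.
- have := eqv_raise_swap u v (pre ++ map (lift h) g) hu hv.
  rewrite -!/(lift _ _) => E; apply: eqv_trans _ (eqv_trans E _).
    by do 2!(apply: eqv_cons; first by solve_perm).
  by do 2!(apply: eqv_cons; first by solve_perm).
- by rewrite (lift_eq hv); apply: eqv_cons => //; solve_perm.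
- by rewrite (lift_eq hu); apply: eqv_cons => //; solve_perm.
Qed.

(** Adjacent swaps suffice: [front] brings the head of [g1] to the front of [g2], and the tails are
    handled by induction. *)
Lemma stair_perm h h' pre g1 g2 : below g1 h h' -> perm_eq g1 g2 ->
  eqv (stair h h' pre g1) (stair h h' pre g2).
Proof.
have front u a b : forall p, below (a ++ u :: b) h h' ->
    eqv (stair h h' p (a ++ u :: b)) (stair h h' p (u :: a ++ b)).
  elim: a => [|v a IH] p H; first exact: eqv_refl.
  apply: eqv_trans _ (stair_swap _ _); last first.
    by apply: below_perm H; solve_perm.
  rewrite !cat_cons [stair _ _ _ (v :: a ++ _)]/= [stair _ _ _ (v :: u :: _)]/=.
  apply: eqv_cat; last by apply: IH; case/below_cons: H.
  case: ifP => // _; apply: eqv_cons => //; rewrite !perm_cons perm_cat2l.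
  by rewrite -map_cons; apply: perm_map; solve_perm.
elim: g1 pre g2 => [|u g1 IH] pre g2 H p.
  by move: p; rewrite perm_sym => /perm_nilP->.
have ug2 : u \in g2 by rewrite -(perm_mem p) mem_head.
move: p (below_perm p H); case/splitPr: ug2 => a b p Hab.
apply: eqv_trans _ (eqv_sym (front _ _ _ _ Hab)).
rewrite [stair _ _ _ (u :: g1)]/= [stair _ _ _ (u :: a ++ _)]/=.
have p' : perm_eq g1 (a ++ b).
  by rewrite -(perm_cons u); apply: perm_trans p _; solve_perm.
apply: eqv_cat; last by apply: IH => //; case/below_cons: H.
case: ifP => // _; apply: eqv_cons => //.
by rewrite !perm_cons perm_cat2l; apply: perm_map.
Qed.

Lemma comb_lt (t a b c d : R) : 0 < t -> t < 1 -> a <= b -> c <= d ->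
  a < b \/ c < d -> (1 - t) * a + t * c < (1 - t) * b + t * d.
Proof. move=> t0 t1 ab cd [H|H]; nra. Qed.

(** Everything happens in the quadrilateral over the edge from [x] to [y], coned over [pre]. It
    degenerates to a triangle or a segment when the heights agree at one end or both, hence four
    cases. *)
Lemma stair_split2 h h' pre x y w t : 0 < t -> t < 1 -> w = (1 - t) *: x + t *: y ->
    below [:: x; y] h h' ->
  eqv (stair h h' pre [:: x; y]) (stair h h' pre [:: w; y] ++ stair h h' pre [:: x; w]).
Proof.
move=> t0 t1 wE /below_cons[hx /below_cons[hy _]].
have lw : lift h w = (1 - t) *: lift h x + t *: lift h y by rewrite wE lift_comb.
have lw' : lift h' w = (1 - t) *: lift h' x + t *: lift h' y by rewrite wE lift_comb.
have evw f : ev f w = (1 - t) * ev f x + t * ev f y by rewrite wE evD !evZ.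
have hw : ev h x < ev h' x \/ ev h y < ev h' y -> ev h w < ev h' w.
  by move=> H; rewrite !evw; apply: comb_lt => //; [case: hx|case: hy]; lra.
case: hx => hx; case: hy => hy; rewrite /= ?hx ?hy ?ltxx /=.
- rewrite hw /=; last by left.
  set a := lift h x; set b := lift h' x; set c := lift h y; set d := lift h' y.
  set p := lift h w; set q := lift h' w.
  (* After splitting the lower edge at [p] and the upper edge at [q], only the diagonal of the
     quadrilateral [p], [c], [q], [b] is wrong. The diagonals cross above [w], and [r] is the
     relative height of the crossing between [p] and [q]. *)
  pose z := (1 - t) *: b + t *: c.
  pose r := (1 - t) * (ev h' x - ev h x) / (ev h' w - ev h w).
  have hw0 : 0 < ev h' w - ev h w by rewrite subr_gt0; apply: hw; left.
  have hw1 : ev h' w - ev h w != 0 by rewrite gt_eqF.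
  have r0 : 0 < r by rewrite divr_gt0 // mulr_gt0 // subr_gt0.
  have r1 : r < 1 by rewrite ltr_pdivrMr // !evw; nra.
  have zE : z = (1 - r) *: p + r *: q.
    rewrite /z /b /c /p /q /lift /r !evw wE; move: hw1; rewrite !evw => hw1.
    by vector_field.
  apply: (@eqv_trans ([:: [:: p, c, b & pre]; [:: a, p, b & pre]] ++
      [:: [:: q, d, c & pre]; [:: b, q, c & pre]])).
    apply: (@eqv_cat [:: _] _ [:: _]).
      by apply: eqv_trans _ (@eqv_split1 a c p (b :: pre) t t0 t1 lw);
        apply: eqv_cons => //; solve_perm.
    apply: eqv_trans _ (@eqv_split1 b d q (c :: pre) t t0 t1 lw').
    by apply: eqv_cons => //; solve_perm.
  apply: (@eqv_permL _ ([:: [:: p, c, b & pre]; [:: b, q, c & pre]] ++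
      [:: [:: a, p, b & pre]; [:: q, d, c & pre]])); first by solve_perm.
  apply: (@eqv_permR _ ([:: [:: p, q & pre ++ [:: c]]; [:: p, q & b :: pre ++ [::]]] ++
      [:: [:: a, b & pre ++ [:: p]]; [:: c, d & q :: pre ++ [::]]])); first by solve_perm.
  apply: eqv_cat; last first.
    apply: eqv_cons; first by solve_perm.
    by apply: eqv_cons => //; solve_perm.
  apply: eqv_trans _ (eqv_trans (eqv_sym (@eqv_flip _ _ _ _ z pre _ _ r0 r1 t0 t1 zE erefl)) _).
    apply: eqv_cons; first by solve_perm.
    by apply: eqv_cons => //; solve_perm.
  by apply: eqv_cons; [solve_perm|apply: eqv_cons => //; solve_perm].
- rewrite hw /=; last by left.
  set a := lift h x; set b := lift h' x; set c := lift h y.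
  set p := lift h w; set q := lift h' w.
  apply: (@eqv_trans [:: [:: p, c, b & pre]; [:: a, p, b & pre]]).
    by apply: eqv_trans _ (@eqv_split1 a c p (b :: pre) t t0 t1 lw);
      apply: eqv_cons => //; solve_perm.
  apply: (@eqv_trans ([:: [:: q, c, p & pre]; [:: b, q, p & pre]] ++ [:: [:: a, p, b & pre]])).
    apply: (@eqv_cat [:: _] _ [:: _]) => //.
    apply: eqv_trans _ (@eqv_split1 b c q (p :: pre) t t0 t1 _).
      by apply: eqv_cons => //; solve_perm.
    by rewrite /q lw' -(lift_eq hy).
  apply: eqv_cons; first by solve_perm.
  apply: (@eqv_permL _ [:: [:: a, p, b & pre]; [:: b, q, p & pre]]); first by solve_perm.
  by do 2!(apply: eqv_cons; first by solve_perm).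
- rewrite hw /=; last by right.
  rewrite -(lift_eq hx).
  set a := lift h x; set c := lift h y; set d := lift h' y.
  set p := lift h w; set q := lift h' w.
  apply: (@eqv_trans [:: [:: q, d, c & pre]; [:: a, q, c & pre]]).
    apply: eqv_trans _ (@eqv_split1 a d q (c :: pre) t t0 t1 _).
      by apply: eqv_cons => //; solve_perm.
    by rewrite /q lw' -(lift_eq hx).
  apply: (@eqv_trans ([:: [:: q, d, c & pre]] ++ [:: [:: p, c, q & pre]; [:: a, p, q & pre]])).
    apply: (@eqv_cat [:: _] _ [:: _]) => //.
    apply: eqv_trans _ (@eqv_split1 a c p (q :: pre) t t0 t1 lw).
    by apply: eqv_cons => //; solve_perm.
  apply: (@eqv_permL _ [:: [:: p, c, q & pre]; [:: q, d, c & pre]; [:: a, p, q & pre]]);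
    first by solve_perm.
  by do 3!(apply: eqv_cons; first by solve_perm).
- by rewrite !evw hx hy ltxx.
Qed.

(** Reordering puts [x] and [y] last. While a vertex of [G] is raised, both still sit on the lower
    graph, so its simplex contains the lower edge and is split at [lift h w]; the end of the
    staircase is [stair_split2]. *)
Lemma stair_split h h' x y w G t : 0 < t -> t < 1 -> w = (1 - t) *: x + t *: y ->
    below [:: x, y & G] h h' ->
  eqv (stair h h' [::] [:: x, y & G])
      (stair h h' [::] [:: w, y & G] ++ stair h h' [::] [:: x, w & G]).
Proof.
move=> t0 t1 wE H.
have evw f : ev f w = (1 - t) * ev f x + t * ev f y by rewrite wE evD !evZ.
have hx : ev h x <= ev h' x by apply: H; rewrite !inE eqxx.
have hy : ev h y <= ev h' y by apply: H; rewrite !inE eqxx orbT.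
have hw : ev h w <= ev h' w by rewrite !evw; nra.
have HG : below G h h' by move=> v vG; apply: H; rewrite !inE vG !orbT.
have rot (p : seq W) a b : perm_eq [:: a, b & p] (p ++ [:: a; b]) by solve_perm.
have Hab a b : ev h a <= ev h' a -> ev h b <= ev h' b -> below [:: a, b & G] h h'.
  by move=> Ha Hb v; rewrite !inE => /or3P[/eqP->|/eqP->|/HG].
suff main pre g : below g h h' -> eqv (stair h h' pre (g ++ [:: x; y]))
    (stair h h' pre (g ++ [:: w; y]) ++ stair h h' pre (g ++ [:: x; w])).
  apply: eqv_trans (stair_perm _ H (rot _ _ _)) _.
  apply: eqv_trans (main _ _ HG) _; apply: eqv_sym.
  by apply: eqv_cat; (apply: stair_perm (rot _ _ _); apply: Hab).
elim: g pre => [|v g IH] pre Hg.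
  by apply: stair_split2 wE _ => //; move=> v; rewrite !inE => /orP[]/eqP->.
case/below_cons: Hg => _ /(IH (lift h' v :: pre)) {}IH; rewrite !cat_cons /=.
case: ifP => _; last exact: IH.
set P1 := stair _ _ _ _ in IH *; set P2 := stair _ _ _ _ in IH *.
set P3 := stair _ _ _ _ in IH *.
set K := [:: lift h v, lift h' v & pre ++ map (lift h) g].
set a := lift h x; set c := lift h y; set p := lift h w.
apply: (@eqv_trans ([:: [:: p, c & K]; [:: a, p & K]] ++ (P2 ++ P3))).
  apply: (@eqv_cat [:: _]) => //.
  apply: eqv_trans _ (@eqv_split1 a c p K t t0 t1 _); last by rewrite /p wE lift_comb.
  by apply: eqv_cons => //; rewrite map_cat /K ?/a ?/c ?/p; solve_perm.
apply: (@eqv_permR _ ([:: [:: lift h v, lift h' v & pre ++ map (lift h) (g ++ [:: w; y])];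
  [:: lift h v, lift h' v & pre ++ map (lift h) (g ++ [:: x; w])]] ++ (P2 ++ P3)));
  first by solve_perm.
apply: eqv_cat => //.
by do 2!(apply: eqv_cons; first by rewrite map_cat /K ?/a ?/c ?/p; solve_perm).
Qed.

(** A split adds only a convex combination of old vertices and loses none. This lets [eqv_stair]
    recover [below] for the intermediate families met in symmetric and transitive steps. *)
Lemma eqv_vertex_closed (Q : W -> Prop) l1 l2 :
    (forall a b x y, 0 <= a -> 0 <= b -> Q x -> Q y -> Q (a *: x + b *: y)) ->
    eqv l1 l2 ->
  (forall s, s \in l1 -> forall v, v \in s -> Q v) <->
  (forall s, s \in l2 -> forall v, v \in s -> Q v).
Proof.
move=> Qc; elim=> {l1 l2}.
- by move=> l1 l2 p; split=> H s sl; apply: H; move: sl; rewrite (perm_mem p).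
- move=> s1 s2 l p; split=> H s; rewrite inE => /predU1P[->|sl] v vs.
  + by apply: (H s1); rewrite ?mem_head // (perm_mem p).
  + by apply: (H s) => //; rewrite inE sl orbT.
  + by apply: (H s2); rewrite ?mem_head // -(perm_mem p).
  + by apply: (H s) => //; rewrite inE sl orbT.
- move=> x y w G l t t0 t1 wE; split=> H s.
  + have Hxy v : v \in [:: x, y & G] -> Q v by apply: H; rewrite mem_head.
    have Qw : Q w.
      by rewrite wE; apply: Qc; rewrite ?subr_ge0 ?ltW //; apply: Hxy; rewrite !inE eqxx ?orbT.
    rewrite !inE => /or3P[/eqP->|/eqP->|sl] v.
    * rewrite inE => /predU1P[->//|vs]; apply: Hxy.
      by rewrite inE vs orbT.
    * rewrite !inE => /or3P[/eqP->|/eqP->//|vs]; apply: Hxy; by rewrite !inE ?eqxx ?vs ?orbT.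
    * by apply: (H s); rewrite inE sl orbT.
  + rewrite inE => /predU1P[->|sl] v.
      rewrite !inE => /or3P[/eqP->|/eqP->|vG].
      * by apply: (H (x :: w :: G)); rewrite !inE eqxx ?orbT.
      * by apply: (H (w :: y :: G)); rewrite !inE eqxx ?orbT.
      * by apply: (H (w :: y :: G)); rewrite !inE ?eqxx ?vG ?orbT.
    by apply: (H s); rewrite !inE sl !orbT.
- by move=> l1 l2 _ [? ?].
- by move=> l2 l1 l3 _ i1 _; apply: iff_trans i1.
Qed.

Lemma eqv_stair h h' l1 l2 :
    eqv l1 l2 -> (forall s, s \in l1 -> below s h h') ->
  eqv (flatten [seq stair h h' [::] s | s <- l1]) (flatten [seq stair h h' [::] s | s <- l2]).
Proof.
have Qc (a b : R) x y : 0 <= a -> 0 <= b -> ev h x <= ev h' x -> ev h y <= ev h' y ->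
    ev h (a *: x + b *: y) <= ev h' (a *: x + b *: y).
  by move=> a0 b0 hx hy; rewrite !evD !evZ; apply: lerD; apply: ler_wpM2l.
elim=> {l1 l2}.
- by move=> l1 l2 p _; apply/eqv_perm/perm_flatten/perm_map.
- move=> s1 s2 l p H; apply: eqv_catr; apply: stair_perm p.
  by apply: H; rewrite mem_head.
- move=> x y w G l t t0 t1 wE H.
  set F := flatten [seq stair h h' [::] s | s <- l].
  rewrite -[X in eqv _ X]/(_ ++ (_ ++ F)) catA; apply: eqv_catr.
  by apply: (stair_split t0 t1 wE); apply: H; rewrite mem_head.
- move=> l1 l2 e12 IH H; apply/eqv_sym/IH.
  exact/(@eqv_vertex_closed (fun v => ev h v <= ev h' v) _ _ Qc e12).
- move=> l2 l1 l3 e12 IH1 _ IH2 H.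
  apply: eqv_trans (IH1 H) (IH2 _).
  exact/(@eqv_vertex_closed (fun v => ev h v <= ev h' v) _ _ Qc e12).
Qed.

(** On the left [x] is raised after the vertices of [g], on the right before them. Moving it across
    costs one trapezoid flip for each vertex of [g] whose two heights differ. *)
Lemma stair_exchange h h' x (a b : R) pre g : a < b -> below g h h' ->
  eqv (stair h h' (x + a *: e :: pre) g ++
         [:: [:: x + a *: e, x + b *: e & pre ++ map (lift h') g]])
      ([:: [:: x + a *: e, x + b *: e & pre ++ map (lift h) g]] ++
         stair h h' (x + b *: e :: pre) g).
Proof.
move=> ab; elim: g pre => [|u g IH] pre //= /below_cons[hu /(IH (lift h' u :: pre)) {}IH].
set A := x + a *: e in IH *; set B := x + b *: e in IH *.
rewrite -!catA -[X in eqv _ X]/([:: _] ++ _).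
set S1 := stair h h' _ g; set S2 := stair h h' _ g.
have {}IH : eqv (S1 ++ [:: [:: A, B & pre ++ lift h' u :: map (lift h') g]])
    ([:: [:: A, B & lift h' u :: pre ++ map (lift h) g]] ++ S2).
  apply: eqv_trans _ (eqv_trans IH (eqv_cat _ _)).
  - apply: eqv_cat; first by apply: stair_pre; solve_perm.
    by apply: eqv_cons => //; solve_perm.
  - by apply: eqv_refl.
  - by apply: stair_pre; solve_perm.
apply: eqv_trans (eqv_cat (eqv_refl _) IH) _; rewrite !catA; apply: eqv_cat => //.
case: hu => hu; rewrite ?hu ?ltxx /=.
  have := @eqv_raise_swap u x (pre ++ map (lift h) g) _ _ _ _ hu ab.
  rewrite -/(lift h u) -/(lift h' u) -/A -/B => E.
  apply: eqv_trans _ (eqv_trans E _).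
    by do 2!(apply: eqv_cons; first by solve_perm).
  by do 2!(apply: eqv_cons; first by solve_perm).
by rewrite (lift_eq hu); apply: eqv_cons => //; solve_perm.
Qed.

Lemma eqv_column_cat x K (a b c : R) : a < b -> b < c ->
  eqv [:: [:: x + a *: e, x + b *: e & K]; [:: x + b *: e, x + c *: e & K]]
      [:: [:: x + a *: e, x + c *: e & K]].
Proof.
move=> ab bc; have ac : a < c by lra.
have n0 : c - a != 0 by apply/eqP; lra.
have p0 : 0 < c - a by lra.
pose t := (b - a) / (c - a).
have t0 : 0 < t by rewrite divr_gt0 //; lra.
have t1 : t < 1 by rewrite ltr_pdivrMr //; lra.
apply: eqv_sym.
apply: eqv_trans (@eqv_split1 _ _ (x + b *: e) K t t0 t1 _) _.
  by rewrite /t; vector_field.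
by apply: eqv_perm; solve_perm.
Qed.

(** The upper staircase raises the head [v] only after the lower one has raised all of [g]. By
    [stair_exchange] that second raising moves forward until it directly follows the first, and the
    two merge by [eqv_column_cat]. *)
Lemma stair_cat h1 h2 h3 pre g : below g h1 h2 -> below g h2 h3 ->
  eqv (stair h1 h2 pre g ++ stair h2 h3 pre g) (stair h1 h3 pre g).
Proof.
elim: g pre => [|v g IH] pre //= /below_cons[e12 b12] /below_cons[e23 b23].
have E13 : eqv (stair h1 h2 (lift h3 v :: pre) g ++ stair h2 h3 (lift h3 v :: pre) g)
    (stair h1 h3 (lift h3 v :: pre) g) by apply: IH.
case: e23 => e23; last first.
  rewrite -e23 ltxx /= -catA; by apply: eqv_cat; rewrite (lift_eq e23).
rewrite e23 -catA.
apply: eqv_trans (eqv_cat (eqv_refl _) (_ : eqv _ (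
   [:: [:: lift h2 v, lift h3 v & pre ++ map (lift h1) g]] ++
   (stair h1 h2 (lift h3 v :: pre) g ++ stair h2 h3 (lift h3 v :: pre) g)))) _.
  rewrite !catA; apply: eqv_cat => //.
  exact: stair_exchange.
rewrite catA; apply: eqv_cat => //.
case: e12 => e12.
  by rewrite e12 (lt_trans e12 e23); apply: eqv_column_cat.
by rewrite e12 ltxx e23 /= (lift_eq e12).
Qed.

End Staircase.

End Equivalence.

#[local] Hint Resolve eqv_refl : core.

(** * Simplicial cones *)

Section SimplicialCones.
Context {R : realFieldType} {W : vectType R}.
Notation dual := 'Hom(W, R^o).
Implicit Types (s g pre G r : seq W) (l : seq (seq W)) (f h k : dual).
Implicit Types (u v w x y z : W) (t : R) (m : nat) (fs : seq dual).

(** Coordinate form of [v] in the basis [s] of its span. It is specified only for free [s], and only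
    on that span. *)
Definition bdual s v : dual :=
  linfun (sval (linear_of_free s [seq ((u == v)%:R : R^o) | u <- s])).

Lemma dual_interp_seq s (vals : seq R) : free s -> size vals = size s ->
  exists f, map (ev f) s = vals.
Proof.
move=> fs E; case: (linear_of_free s (vals : seq R^o)) => f /(_ fs E) fE.
by exists (linfun f); rewrite -[RHS]fE; apply: eq_map => v; rewrite /ev lfunE.
Qed.

Lemma dual_interp s (a : W -> R) : free s -> exists f, forall v, v \in s -> ev f v = a v.
Proof.
move=> fs; have [f fE] := dual_interp_seq fs (size_map a s).
by exists f => v; move: v; apply/eq_in_map.
Qed.

Lemma bdualE s u v : free s -> u \in s -> ev (bdual s v) u = (u == v)%:R.
Proof.
move=> fs us; rewrite /bdual; case: (linear_of_free _ _) => f /= /(_ fs).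
rewrite size_map => /(_ erefl) E; rewrite /ev lfunE.
have := congr1 (fun vals => nth 0 vals (index u s)) E.
by rewrite !(nth_map 0) ?index_mem // nth_index.
Qed.

Lemma span_bdual s x : free s -> x \in <<s>>%VS ->
  x = \sum_(v <- s) ev (bdual s v) x *: v.
Proof.
move=> fs xs; have [k xE _] := free_span fs xs.
rewrite {1}xE; apply: eq_big_seq => v vs; congr (_ *: _).
rewrite xE ev_sum (bigD1_seq v) ?free_uniq //= evZ bdualE // eqxx mulr1.
rewrite big_seq_cond big1 ?addr0 // => u /andP[us nuv].
by rewrite evZ bdualE // (negbTE nuv) mulr0.
Qed.

Inductive pos s : W -> Prop :=
| pos0 : pos s 0
| pos_step v (a : R) x : v \in s -> 0 <= a -> pos s x -> pos s (a *: v + x).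

Lemma pos_mem s v : v \in s -> pos s v.
Proof.
move=> vs; rewrite -[v]scale1r -[X in pos _ X]addr0.
by apply: pos_step => //; apply: pos0.
Qed.

Lemma posD s x y : pos s x -> pos s y -> pos s (x + y).
Proof.
by move=> px py; elim: px => [|v a z vs a0 _ IH]; rewrite ?add0r // -addrA; constructor.
Qed.

Lemma posZ s (a : R) x : 0 <= a -> pos s x -> pos s (a *: x).
Proof.
move=> a0; elim=> [|v b z vs b0 _ IH]; first by rewrite scaler0; constructor.
by rewrite scalerDr scalerA; constructor => //; apply: mulr_ge0.
Qed.

Lemma pos_sub s1 s2 x : (forall v, v \in s1 -> pos s2 v) -> pos s1 x -> pos s2 x.
Proof.
move=> H; elim=> [|v a z vs a0 _ IH]; first by constructor.
by apply: posD => //; apply: posZ => //; apply: H.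
Qed.

Lemma pos_perm s1 s2 x : perm_eq s1 s2 -> pos s1 x -> pos s2 x.
Proof. by move=> p; apply: pos_sub => v; rewrite (perm_mem p); apply: pos_mem. Qed.

Lemma pos_behead v s x : pos s x -> pos (v :: s) x.
Proof. by apply: pos_sub => u us; apply: pos_mem; rewrite inE us orbT. Qed.

Lemma pos_cons v s x :
  pos (v :: s) x -> exists (a : R) y, [/\ 0 <= a, pos s y & x = a *: v + y].
Proof.
elim=> [|u a z us a0 _ [b [y [b0 py ->]]]].
  by exists 0, 0; rewrite scale0r addr0; split=> //; constructor.
move: us; rewrite inE => /predU1P[->|us].
  by exists (a + b), y; rewrite scalerDl addrA; split=> //; apply: addr_ge0.
by exists b, (a *: u + y); rewrite addrCA; split=> //; constructor.
Qed.

Lemma pos_span s x : pos s x -> x \in <<s>>%VS.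
Proof.
elim=> [|v a z vs a0 _ IH]; first exact: mem0v.
by apply: memvD => //; apply: memvZ; apply: memv_span.
Qed.

Lemma pos_ge0 f s x : (forall v, v \in s -> 0 <= ev f v) -> pos s x -> 0 <= ev f x.
Proof.
move=> H; elim=> [|v a z vs a0 _ IH]; first by rewrite ev0.
by rewrite evD evZ addr_ge0 // mulr_ge0 // H.
Qed.

Lemma pos_le0 f s x : (forall v, v \in s -> ev f v <= 0) -> pos s x -> ev f x <= 0.
Proof.
move=> H; elim=> [|v a z vs a0 _ IH]; first by rewrite ev0.
by rewrite evD evZ; have := mulr_ge0_le0 a0 (H v vs); lra.
Qed.

Lemma pos_bdual s x : free s -> x \in <<s>>%VS ->
  (forall v, v \in s -> 0 <= ev (bdual s v) x) -> pos s x.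
Proof.
move=> fs xs H; rewrite (span_bdual fs xs).
suff main r : {subset r <= s} -> pos s (\sum_(v <- r) ev (bdual s v) x *: v) by apply: main.
elim: r => [|v r IH] rs; first by rewrite big_nil; constructor.
rewrite big_cons; constructor; [by apply: rs; rewrite mem_head| |].
  by apply: H; apply: rs; rewrite mem_head.
by apply: IH => u ur; apply: rs; rewrite inE ur orbT.
Qed.

Lemma bdual_ge0 s v x : free s -> pos s x -> 0 <= ev (bdual s v) x.
Proof. by move=> fs; apply: pos_ge0 => u us; rewrite bdualE. Qed.

Lemma span_vanish f s x : (forall v, v \in s -> ev f v = 0) -> x \in <<s>>%VS -> ev f x = 0.
Proof.
move=> H xs; have /subvP/(_ x xs) : (<<s>> <= lker f)%VS.
  by apply/span_subvP => v /H fv; rewrite memv_ker; apply/eqP.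
by rewrite memv_ker => /eqP.
Qed.

Lemma subset_span_eq s1 s2 : free s1 -> free s2 -> size s1 = size s2 ->
  (forall v, v \in s1 -> v \in <<s2>>%VS) -> <<s1>>%VS = <<s2>>%VS.
Proof.
move=> f1 f2 E H; apply/eqP; rewrite eqEdim; apply/andP; split; first exact/span_subvP.
by move: f1 f2; rewrite /free => /eqP-> /eqP->; rewrite E.
Qed.

Lemma span_split x y w G t : 0 < t -> t < 1 -> w = (1 - t) *: x + t *: y ->
  <<[:: w, y & G]>>%VS = <<[:: x, y & G]>>%VS.
Proof.
move=> t0 t1 wE; have n1 : 1 - t != 0 by apply/eqP; lra.
have xE : x = (1 - t)^-1 *: w - ((1 - t)^-1 * t) *: y by rewrite wE; vector_field.
apply/eqP; rewrite eqEsubv; apply/andP; split; apply/span_subvP => v.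
  rewrite inE => /predU1P[->|vs]; last by apply: memv_span; rewrite inE vs orbT.
  by rewrite wE; apply: memvD; apply: memvZ; apply: memv_span; rewrite !inE eqxx ?orbT.
rewrite inE => /predU1P[->|vs]; last by apply: memv_span; rewrite inE vs orbT.
by rewrite xE; apply: memvB; apply: memvZ; apply: memv_span; rewrite !inE eqxx ?orbT.
Qed.

Lemma free_split x y w G t : 0 < t -> t < 1 -> w = (1 - t) *: x + t *: y ->
  free [:: w, y & G] = free [:: x, y & G].
Proof. by move=> t0 t1 wE; rewrite /free (span_split G t0 t1 wE). Qed.

Lemma comb_swap x y w t : w = (1 - t) *: x + t *: y -> w = (1 - (1 - t)) *: y + (1 - t) *: x.
Proof. by move->; rewrite subKr addrC. Qed.

Variable ell : dual.

(* ell stands for the last coordinate: vectors with ell v = 1 are points, and free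
   means affinely independent. *)
Definition simp m s := [/\ free s, size s = m & forall v, v \in s -> ev ell v = 1].

Lemma simp_perm m s1 s2 : perm_eq s1 s2 -> simp m s1 -> simp m s2.
Proof.
move=> p [f z e]; split; rewrite -?(perm_free p) -?(perm_size p) //.
by move=> v; rewrite -(perm_mem p); apply: e.
Qed.

Lemma perm_head2 (x y : W) G : perm_eq [:: x, y & G] [:: y, x & G].
Proof. by apply/permPl/(perm_catCA [:: x] [:: y]). Qed.

Lemma simp_split m x y w G t : 0 < t -> t < 1 -> w = (1 - t) *: x + t *: y ->
  simp m [:: x, y & G] -> simp m [:: w, y & G] /\ simp m [:: x, w & G].
Proof.
move=> t0 t1 wE.
have half (a b c : W) (k : R) : 0 < k -> k < 1 -> c = (1 - k) *: a + k *: b ->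
    simp m [:: a, b & G] -> simp m [:: c, b & G].
  move=> k0 k1 cE [f z e]; split=> //; first by rewrite (free_split _ k0 k1 cE).
  move=> v; rewrite inE => /predU1P[->|vs]; last by apply: e; rewrite inE vs orbT.
  by rewrite cE evD !evZ !e ?inE ?eqxx ?orbT // !mulr1 subrK.
move=> S; split; first exact: (half x y w t).
apply: simp_perm (perm_head2 _ _ _) _.
apply: (half y x w (1 - t)); [lra|lra|exact: comb_swap|].
exact: simp_perm (perm_head2 _ _ _) S.
Qed.

Lemma simp_merge m x y w G t : 0 < t -> t < 1 -> w = (1 - t) *: x + t *: y ->
  simp m [:: w, y & G] -> simp m [:: x, w & G] -> simp m [:: x, y & G].
Proof.
move=> t0 t1 wE [f z e] [_ _ e']; split=> //; first by rewrite -(free_split _ t0 t1 wE).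
move=> v; rewrite inE => /predU1P[->|vs]; first by rewrite e' ?mem_head.
by rewrite e // inE vs orbT.
Qed.

Lemma pos_comb x y w s t : 0 < t -> t < 1 -> w = (1 - t) *: x + t *: y ->
  pos s x -> pos s y -> pos s w.
Proof. by move=> t0 t1 -> px py; apply: posD; apply: posZ => //; lra. Qed.

Lemma pos_split_sub x y w G t z : 0 < t -> t < 1 -> w = (1 - t) *: x + t *: y ->
  pos [:: w, y & G] z \/ pos [:: x, w & G] z -> pos [:: x, y & G] z.
Proof.
move=> t0 t1 wE.
have pw : pos [:: x, y & G] w.
  by apply: pos_comb wE _ _ => //; apply: pos_mem; rewrite !inE eqxx ?orbT.
case; apply: pos_sub => v; rewrite !inE => /or3P[/eqP->|/eqP->|vG] //;
  by apply: pos_mem; rewrite !inE ?eqxx ?vG ?orbT.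
Qed.

(** Eliminating [y] in favour of [w] changes the coefficient of [x] to one with the sign of
    [ev f z], because [f] vanishes on [w] and [G]. *)
Lemma pos_splitr f x y w G t z : 0 < t -> t < 1 -> w = (1 - t) *: x + t *: y ->
    (forall v, v \in G -> ev f v = 0) -> ev f w = 0 -> 0 < ev f x ->
  pos [:: x, y & G] z -> 0 <= ev f z -> pos [:: x, w & G] z.
Proof.
move=> t0 t1 wE fG fw fx /pos_cons[a [z1 [a0 /pos_cons[b [z2 [b0 p2 ->]]] ->]]].
have fz2 : ev f z2 = 0.
  apply/eqP; rewrite eq_le; apply/andP; split.
    by apply: pos_le0 p2 => v /fG->.
  by apply: pos_ge0 p2 => v /fG->.
rewrite !evD !evZ fz2 addr0 => fz.
have nt : t != 0 by rewrite gt_eqF.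
have -> : a *: x + (b *: y + z2) = (a - b * (1 - t) / t) *: x + ((b / t) *: w + z2).
  by rewrite wE; vector_field.
have fy : ev f y = - ((1 - t) / t * ev f x).
  move: fw; rewrite wE evD !evZ => E; have H : t * ev f y = - ((1 - t) * ev f x) by lra.
  by rewrite -[LHS](mulKf nt) H; field.
apply: pos_step; first by rewrite mem_head.
  move: fz; rewrite fy mulrN mulrA -mulrBl mulrA pmulr_lge0 //.
apply: pos_step; first by rewrite !inE eqxx orbT.
  by apply: divr_ge0 => //; lra.
by do 2!apply: pos_behead.
Qed.

(** This form defines the wall between the two halves. The values [t] at [x] and [t - 1] at [y]
    cancel at [w]. *)
Lemma split_functional x y w G t : free [:: x, y & G] ->
    0 < t -> t < 1 -> w = (1 - t) *: x + t *: y ->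
  exists f, [/\ forall v, v \in G -> ev f v = 0, ev f w = 0, 0 < ev f x & ev f y < 0].
Proof.
move=> fr t0 t1 wE.
have [f fE] := dual_interp (fun v => if v == x then t else if v == y then t - 1 else 0) fr.
have := free_uniq fr; rewrite /= inE negb_or => /and3P[/andP[xy xG] yG _].
have fx : ev f x = t by rewrite fE ?mem_head // eqxx.
have fy : ev f y = t - 1.
  by rewrite fE ?inE ?eqxx ?orbT //; case: eqP => // e; rewrite e eqxx in xy.
exists f; rewrite fx fy; split=> //; try lra.
- move=> v vG; rewrite fE ?inE ?vG ?orbT //.
  case: eqP => [e|_]; first by rewrite -e vG in xG.
  by case: eqP => // e; rewrite -e vG in yG.
- by rewrite wE evD !evZ fx fy; ring.
Qed.

Lemma pos_split_ge f x y w G t z : 0 < t -> t < 1 -> w = (1 - t) *: x + t *: y ->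
    (forall v, v \in G -> ev f v = 0) -> ev f w = 0 -> 0 < ev f x ->
    pos [:: x, y & G] z ->
  (0 <= ev f z -> pos [:: x, w & G] z) /\ (ev f z <= 0 -> pos [:: w, y & G] z).
Proof.
move=> t0 t1 wE fG fw fx pz; split.
  by move=> fz; apply: (pos_splitr t0 t1 wE fG fw fx pz fz).
move=> fz; apply: pos_perm (perm_head2 _ _ _) _.
have ef v : ev (- f) v = - ev f v by rewrite /ev opp_lfunE.
have fy : ev f y < 0 by move: fw; rewrite wE evD !evZ; nra.
apply: (@pos_splitr (- f) y x w G (1 - t)).
- by lra.
- by lra.
- exact: comb_swap.
- by move=> v vG; rewrite ef fG // oppr0.
- by rewrite ef fw oppr0.
- by rewrite ef; lra.
- exact: pos_perm (perm_head2 _ _ _) pz.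
- by rewrite ef; lra.
Qed.

(** * Cutting by linear forms, overlap, and invariance of triangulations under moves *)

Definition uncut f s :=
  (forall v, v \in s -> 0 <= ev f v) \/ (forall v, v \in s -> ev f v <= 0).

Lemma uncut_sub f s1 s2 : (forall v, v \in s1 -> pos s2 v) -> uncut f s2 -> uncut f s1.
Proof.
move=> H [U|U]; [left|right] => v /H; first exact: pos_ge0.
exact: pos_le0.
Qed.

Lemma uncut_opp f h s : uncut (f - h) s -> uncut (h - f) s.
Proof.
by case=> H; [right|left] => v /H; rewrite !ev_subf; lra.
Qed.

Definition dissected m s l := [/\ eqv [:: s] l,
  forall s', s' \in l -> simp m s' /\ (forall v, v \in s' -> pos s v) &
  forall x, pos s x -> exists2 s', s' \in l & pos s' x].

Lemma dissected_refl m s : simp m s -> dissected m s [:: s].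
Proof.
move=> S; split=> //; last by move=> x px; exists s; rewrite ?mem_head.
by move=> s'; rewrite inE => /eqP->; split=> // v; apply: pos_mem.
Qed.

Lemma dissected_flatten m s l (F : seq W -> seq (seq W)) :
    dissected m s l -> (forall s', s' \in l -> dissected m s' (F s')) ->
  dissected m s (flatten [seq F s' | s' <- l]).
Proof.
move=> [e S C] H; split.
- apply: eqv_trans e _; rewrite -[l in eqv l _](flatten_seq1 l).
  by apply: eqv_flatten => s' /H[].
- move=> s2 /flatten_mapP[s1 s1l /(let: And3 _ S' _ := H _ s1l in S' s2)[S2 P2]].
  by split=> // v /P2; apply: pos_sub => u us; case: (S _ s1l) => _; apply.
- move=> x /C[s1 s1l] px; case: (H _ s1l) => _ _ /(_ x px)[s2 s2F p2].
  by exists s2 => //; apply/flatten_mapP; exists s1.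
Qed.

(** An edge whose ends have opposite strict signs is split at the zero of [f] on it. In each half
    one end is replaced by a zero of [f], so the number of vertices off the zero set drops. *)
Lemma cut_functional m f s : simp m s ->
  exists2 l, dissected m s l & forall s', s' \in l -> uncut f s'.
Proof.
have [k] := ubnP (count (fun v => ev f v != 0) s); elim: k s => // k IH s ck S.
have [/hasP[x xs fx]|/hasPn Hp] := boolP (has (fun v => 0 < ev f v) s); last first.
  exists [:: s]; first exact: dissected_refl.
  by move=> s'; rewrite inE => /eqP->; right=> v /Hp; rewrite -leNgt.
have [/hasP[y ys fy]|/hasPn Hp] := boolP (has (fun v => ev f v < 0) s); last first.
  exists [:: s]; first exact: dissected_refl.
  by move=> s'; rewrite inE => /eqP->; left=> v /Hp; rewrite -leNgt.
have xy : y != x by apply/eqP => e; move: fy; rewrite e; lra.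
have p1 := perm_to_rem xs; have yr : y \in rem x s.
  by move: ys; rewrite (perm_mem p1) inE (negbTE xy).
have p2 : perm_eq s [:: x, y & rem y (rem x s)].
  by apply: perm_trans p1 _; rewrite perm_cons perm_to_rem.
move: (rem y _) p2 => G p {p1 yr}.
pose t := ev f x / (ev f x - ev f y).
have p0 : 0 < ev f x - ev f y by lra.
have n0 : ev f x - ev f y != 0 by rewrite gt_eqF.
have t0 : 0 < t by rewrite divr_gt0.
have t1 : t < 1 by rewrite ltr_pdivrMr //; lra.
pose w := (1 - t) *: x + t *: y.
have fw : ev f w = 0 by rewrite /w evD !evZ /t; field.
have S' : simp m [:: x, y & G] by apply: simp_perm p S.
have [S1 S2] := simp_split t0 t1 (erefl w) S'.
have cE : count (fun v => ev f v != 0) s = (count (fun v => ev f v != 0) G).+2.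
  by rewrite (permP p) /= (gt_eqF fx) (lt_eqF fy).
rewrite cE in ck.
have [l1 D1 U1] : exists2 l, dissected m [:: w, y & G] l & forall s', s' \in l -> uncut f s'.
  by apply: IH => //=; rewrite fw eqxx (lt_eqF fy) /= add0n add1n -ltnS.
have [l2 D2 U2] : exists2 l, dissected m [:: x, w & G] l & forall s', s' \in l -> uncut f s'.
  by apply: IH => //=; rewrite fw eqxx (gt_eqF fx) /= add0n add1n -ltnS.
exists (l1 ++ l2); last by move=> s'; rewrite mem_cat => /orP[]; [apply: U1|apply: U2].
have sub12 z : pos [:: w, y & G] z \/ pos [:: x, w & G] z -> pos s z.
  move=> /(pos_split_sub t0 t1 (erefl w)); apply: pos_perm; by rewrite perm_sym.
case: D1 D2 => e1 P1 C1 [e2 P2 C2]; split.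
- apply: eqv_trans (eqv_vertices _ p) _.
  apply: eqv_trans (eqv_split1 G t0 t1 (erefl w)) _.
  exact: (@eqv_cat _ _ [:: _] _ [:: _]).
- move=> s'; rewrite mem_cat => /orP[/P1|/P2] [Ss Ps]; split=> // v /Ps pv; apply: sub12; auto.
- move=> z /(pos_perm p) pz.
  have [h [hG hw hx hy]] := split_functional (let: And3 f _ _ := S' in f) t0 t1 (erefl w).
  have [Ge Le] := pos_split_ge t0 t1 (erefl w) hG hw hx pz.
  case: (leP 0 (ev h z)) => hz.
    by have [s' sl ps] := C2 _ (Ge hz); exists s'; rewrite // mem_cat sl orbT.
  by have [s' sl ps] := C1 _ (Le (ltW hz)); exists s'; rewrite // mem_cat sl.
Qed.

Lemma cut_functionals m fs s : simp m s ->
  exists2 l, dissected m s l & forall s' f, s' \in l -> f \in fs -> uncut f s'.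
Proof.
elim: fs s => [|f fs IH] s S; first by exists [:: s] => //; apply: dissected_refl.
have [l D U] := cut_functional f S.
have H s' : exists l', s' \in l -> dissected m s' l' /\
    forall s2 h, s2 \in l' -> h \in fs -> uncut h s2.
  have [sl|] := boolP (s' \in l); last by exists [::].
  have [_ /(_ _ sl)[/IH[l' D' U'] _] _] := D.
  by exists l'.
have [F FP] := choice H.
exists (flatten [seq F s' | s' <- l]).
  by apply: dissected_flatten D _ => s' /FP[].
move=> s2 h /flatten_mapP[s1 s1l s2F]; have [[_ /(_ _ s2F)[_ P] _] U'] := FP _ s1l.
rewrite inE => /predU1P[->|hf]; last exact: U'.
by apply: uncut_sub P _; apply: U.
Qed.

(* The intersection of the two simplices has full dimension. *)
Definition ov m s1 s2 := exists2 r, simp m r & forall v, v \in r -> pos s1 v /\ pos s2 v.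

Lemma ovC m s1 s2 : ov m s1 s2 -> ov m s2 s1.
Proof. by case=> r S H; exists r => // v /H[]. Qed.

Lemma ov_subl m s1 s2 s : (forall x, pos s1 x -> pos s2 x) -> ov m s1 s -> ov m s2 s.
Proof. by move=> H [r S P]; exists r => // v /P[]; auto. Qed.

(** Equal sizes upgrade inclusion to equality of spans. Typical use: a form vanishing on a full-size
    family inside a cone vanishes on the whole cone. *)
Lemma simp_span m s r : simp m s -> simp m r -> (forall v, v \in r -> pos s v) ->
  <<r>>%VS = <<s>>%VS.
Proof.
move=> [fs zs _] [fr zr _] H; apply: subset_span_eq => //; first by rewrite zr.
by move=> v /H/pos_span.
Qed.

(** The overlap is itself cut along the wall; any one piece of it lies on a single side. *)
Lemma split_ov m x y w G t s : 0 < t -> t < 1 -> w = (1 - t) *: x + t *: y ->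
    simp m [:: x, y & G] ->
  ov m [:: x, y & G] s -> ov m [:: w, y & G] s \/ ov m [:: x, w & G] s.
Proof.
move=> t0 t1 wE S [r Sr P].
have [f [fG fw fx fy]] := split_functional (let: And3 f _ _ := S in f) t0 t1 wE.
(* Covering the apex 0 is merely a way to pick some piece [r']. *)
have [l [_ D /(_ 0 (pos0 _))[r' rl _]] U] := cut_functional f Sr.
have [Sr' Pr] := D _ rl.
have P' v : v \in r' -> pos [:: x, y & G] v /\ pos s v.
  by move=> /Pr pv; split; apply: pos_sub pv => u /P[].
case: (U _ rl) => H; [right|left]; exists r' => // v vr; have [pv psv] := P' v vr;
  have [Ge Le] := pos_split_ge t0 t1 wE fG fw fx pv; split=> //.
- by apply: Ge; apply: H.
- by apply: Le; apply: H.
Qed.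

(** A common family would lie in the wall, yet its span contains [x], where the wall form is
    positive. *)
Lemma split_nov m x y w G t : 0 < t -> t < 1 -> w = (1 - t) *: x + t *: y ->
  simp m [:: x, y & G] -> ~ ov m [:: w, y & G] [:: x, w & G].
Proof.
move=> t0 t1 wE S [r Sr P].
have [f [fG fw fx fy]] := split_functional (let: And3 f _ _ := S in f) t0 t1 wE.
have fr v : v \in r -> ev f v = 0.
  move=> /P[p1 p2]; apply/eqP; rewrite eq_le; apply/andP; split.
    by apply: pos_le0 p1 => u; rewrite !inE => /or3P[/eqP->|/eqP->|/fG->] //; rewrite ?fw // ltW.
  by apply: pos_ge0 p2 => u; rewrite !inE => /or3P[/eqP->|/eqP->|/fG->] //; rewrite ?fw // ltW.
suff : ev f x = 0 by move=> E; rewrite E ltxx in fx.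
apply: span_vanish fr _; have [_ S2] := simp_split t0 t1 wE S.
rewrite (simp_span S2 Sr); last by move=> v /P[].
by rewrite memv_span ?mem_head.
Qed.

(* Quantifying over permutations also excludes repeated members of l. *)
Definition nonov m l := forall s1 s2 l', perm_eq l [:: s1, s2 & l'] -> ~ ov m s1 s2.

Lemma nonov_perm m l1 l2 : perm_eq l1 l2 -> nonov m l1 -> nonov m l2.
Proof. by move=> p N s1 s2 l' p'; apply: (N s1 s2 l'); apply: perm_trans p p'. Qed.

Lemma nonov_cons m s l :
  nonov m (s :: l) <-> (forall s', s' \in l -> ~ ov m s s') /\ nonov m l.
Proof.
split=> [N|[N1 N2] s1 s2 l' p].
  split=> [s' sl|s1 s2 l' p].
    by apply: (N s s' (rem s' l)); rewrite perm_cons perm_to_rem.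
  apply: (N s1 s2 (s :: l')).
  by apply: (@perm_trans _ [:: s, s1, s2 & l']); [rewrite perm_cons|solve_perm].
have : s \in [:: s1, s2 & l'] by rewrite -(perm_mem p) mem_head.
rewrite !inE => /or3P[/eqP e|/eqP e|sl].
- subst s1; apply: N1; move: p; rewrite perm_cons => /perm_mem->.
  by rewrite mem_head.
- subst s2; move/ovC; apply: N1.
  have : perm_eq (s :: l) [:: s, s1 & l'] by apply: perm_trans p _; solve_perm.
  by rewrite perm_cons => /perm_mem->; rewrite mem_head.
- apply: (N2 s1 s2 (rem s l')); rewrite -(perm_cons s); apply: perm_trans p _.
  apply: (@perm_trans _ [:: s1, s2, s & rem s l']); last by solve_perm.
  by rewrite !perm_cons perm_to_rem.
Qed.

Lemma nonov_filter m (p : pred (seq W)) l : nonov m l -> nonov m [seq s <- l | p s].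
Proof.
elim: l => //= s l IH /nonov_cons[N1 /IH{}IH]; case: ifP => // _.
by apply/nonov_cons; split=> // s'; rewrite mem_filter => /andP[_]; apply: N1.
Qed.

Definition tri m l (C : W -> Prop) := [/\ forall s, s \in l -> simp m s, nonov m l &
  forall x, C x <-> exists2 s, s \in l & pos s x].

Lemma tri_split m x y w G t l C : 0 < t -> t < 1 -> w = (1 - t) *: x + t *: y ->
  tri m ([:: x, y & G] :: l) C <-> tri m [:: [:: w, y & G], [:: x, w & G] & l] C.
Proof.
move=> t0 t1 wE.
have posE z : simp m [:: x, y & G] ->
    pos [:: x, y & G] z <-> pos [:: w, y & G] z \/ pos [:: x, w & G] z.
  move=> S; split; last exact: pos_split_sub t0 t1 wE.
  have [f [fG fw fx fy]] := split_functional (let: And3 f _ _ := S in f) t0 t1 wE.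
  move=> /(pos_split_ge t0 t1 wE fG fw fx)[Ge Le].
  by case: (leP 0 (ev f z)) => fz; [right; apply: Ge|left; apply: Le; apply: ltW].
have cov z : simp m [:: x, y & G] ->
    (exists2 s, s \in [:: x, y & G] :: l & pos s z) <->
    (exists2 s, s \in [:: [:: w, y & G], [:: x, w & G] & l] & pos s z).
  move=> S; split=> [] [s]; rewrite !inE.
    move=> /predU1P[->|sl pz]; last by exists s; rewrite // !inE sl !orbT.
    move/(posE z S) => [pz|pz]; first by exists [:: w, y & G]; rewrite ?mem_head.
    by exists [:: x, w & G]; rewrite // !inE eqxx orbT.
  move=> /or3P[/eqP->|/eqP->|sl] pz; last by exists s; rewrite // inE sl orbT.
    by exists [:: x, y & G]; rewrite ?mem_head //; apply/(posE z S); left.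
  by exists [:: x, y & G]; rewrite ?mem_head //; apply/(posE z S); right.
split=> [[S N CE]|[S N CE]].
  have Sxy : simp m [:: x, y & G] by apply: S; rewrite mem_head.
  have [S1 S2] := simp_split t0 t1 wE Sxy.
  split; last by move=> z; rewrite CE; apply: cov.
    by move=> s; rewrite !inE => /or3P[/eqP->|/eqP->|sl] //; apply: S; rewrite inE sl orbT.
  have /nonov_cons[N1 N2] := N.
  apply/nonov_cons; split; last first.
    apply/nonov_cons; split=> // s' /N1 H O; apply: H; apply: ov_subl O => z pz.
    by apply/posE; auto.
  move=> s'; rewrite inE => /predU1P[->|/N1 H O]; first exact: split_nov t0 t1 wE Sxy.
  by apply: H; apply: ov_subl O => z pz; apply/posE; auto.
have Sxy : simp m [:: x, y & G].
  by apply: (simp_merge t0 t1 wE); apply: S; rewrite !inE eqxx ?orbT.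
split; last by move=> z; rewrite CE; apply: iff_sym; apply: cov.
  by move=> s; rewrite inE => /predU1P[->|sl] //; apply: S; rewrite !inE sl !orbT.
have /nonov_cons[N1 /nonov_cons[N2 N3]] := N.
apply/nonov_cons; split=> // s' sl /(split_ov t0 t1 wE Sxy)[].
  by apply: N1; rewrite inE sl orbT.
exact: N2.
Qed.

Lemma tri_perm m l1 l2 C : perm_eq l1 l2 -> tri m l1 C -> tri m l2 C.
Proof.
move=> p [S N CE]; split.
- by move=> s; rewrite -(perm_mem p); apply: S.
- exact: nonov_perm p N.
- by move=> x; rewrite CE; split=> [] [s sl ps]; exists s => //; rewrite ?(perm_mem p) // -(perm_mem p).
Qed.

Lemma tri_vertices m s1 s2 l C : perm_eq s1 s2 -> tri m (s1 :: l) C -> tri m (s2 :: l) C.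
Proof.
move=> p [S /nonov_cons[N1 N2] CE]; have p' : perm_eq s2 s1 by rewrite perm_sym.
split.
- move=> s; rewrite inE => /predU1P[->|sl]; last by apply: S; rewrite inE sl orbT.
  by apply: simp_perm p _; apply: S; rewrite mem_head.
- apply/nonov_cons; split=> // s' /N1 H O; apply: H; apply: ov_subl O => z.
  exact: pos_perm.
- move=> x; rewrite CE; split=> [] [s]; rewrite inE => /predU1P[->|sl] ps.
  + by exists s2; rewrite ?mem_head //; apply: pos_perm ps.
  + by exists s; rewrite // inE sl orbT.
  + by exists s1; rewrite ?mem_head //; apply: pos_perm ps.
  + by exists s; rewrite // inE sl orbT.
Qed.

(** Both directions are needed: [eqv] has symmetric steps, and a split is undone by showing that the
    merged simplex is again free and overlaps nothing else. *)
Lemma eqv_tri m l1 l2 C : eqv l1 l2 -> tri m l1 C <-> tri m l2 C.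
Proof.
elim=> {l1 l2}.
- by move=> l1 l2 p; split; apply: tri_perm => //; rewrite perm_sym.
- by move=> s1 s2 l p; split; apply: tri_vertices => //; rewrite perm_sym.
- by move=> x y w G l t t0 t1 wE; apply: tri_split t0 t1 wE.
- by move=> l1 l2 _ i; apply: iff_sym.
- by move=> l2 l1 l3 _ i1 _; apply: iff_trans i1.
Qed.

End SimplicialCones.

(** * Tilings *)

Section Tilings.
Context {R : realFieldType} {W : vectType R}.
Notation dual := 'Hom(W, R^o).
Implicit Types (s g pre G r : seq W) (l : seq (seq W)) (f h k : dual).
Implicit Types (u v w x y z : W) (t : R) (m : nat) (fs : seq dual).
Variable ell : dual.

(** Double counting. It regroups slabs listed column by column into stacks over one base piece. *)
Lemma perm_flatten_exchange (T1 T2 X : eqType) (P : T1 -> T2 -> bool) (F : T1 -> T2 -> seq X)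
    (r1 : seq T1) (r2 : seq T2) :
  perm_eq (flatten [seq flatten [seq F i j | j <- r2 & P i j] | i <- r1])
          (flatten [seq flatten [seq F i j | i <- r1 & P i j] | j <- r2]).
Proof.
apply/permP => a; rewrite !count_flatten !sumnE !big_map.
under eq_bigr => i _ do rewrite count_flatten sumnE !big_map big_filter big_mkcond.
rewrite exchange_big; apply: eq_bigr => j _.
by rewrite count_flatten sumnE !big_map big_filter [RHS]big_mkcond.
Qed.

Lemma perm_partition (T X : eqType) (P : T -> X -> bool)
    (r : seq T) (l : seq X) :
  (forall x : X, x \in l -> count (P^~ x) r = 1%N) ->
  perm_eq (flatten [seq seq.filter (P i) l | i <- r]) l.
Proof.
move=> H; apply/permP => a; rewrite count_flatten sumnE !big_map.
under eq_bigr => i _ do rewrite count_filter -sum1_count big_mkcond.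
rewrite exchange_big -sum1_count [RHS]big_mkcond big_seq [RHS]big_seq.
apply: eq_bigr => x /H; rewrite -sum1_count big_mkcond /=; case: (a x) => //= _.
by rewrite big1.
Qed.

Lemma seq_min (T : eqType) (f : T -> R) (D : seq T) : D != [::] ->
  exists2 d, d \in D & forall d', d' \in D -> f d <= f d'.
Proof.
elim: D => // d D IH _; have [->|/IH[d1 d1D m1]] := eqVneq D [::].
  by exists d; rewrite ?mem_head // => d'; rewrite inE => /eqP->.
have [le|lt] := leP (f d) (f d1).
  exists d; rewrite ?mem_head // => d'; rewrite inE => /predU1P[->//|/m1].
  exact: le_trans.
exists d1; first by rewrite inE d1D orbT.
by move=> d'; rewrite inE => /predU1P[->|/m1//]; apply: ltW.
Qed.

(** The forms are the coordinates of the difference between a vector and its projection to [U]. *)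
Lemma annihilators (U : {vspace W}) :
  exists fs, forall x, x \in U <-> forall f, f \in fs -> ev f x = 0.
Proof.
pose B := vbasis (fullv : {vspace W}).
pose F i : dual := (linfun (coord B i : W -> R^o) \o (\1 - projv U))%VF.
have FE i x : ev (F i) x = crd i (x - projv U x).
  by rewrite /ev /F comp_lfunE lfunE /= add_lfunE opp_lfunE id_lfunE.
exists [seq F i | i <- enum 'I_(\dim (fullv : {vspace W}))] => x; split.
  by move=> xU f /mapP[i _ ->]; rewrite FE projv_id // subrr /crd linear0.
move=> H; suff -> : x = projv U x by apply: memv_proj.
apply/eqP; rewrite -subr_eq0; apply/eqP/crdP => i; rewrite -FE H; last first.
  by apply: map_f; rewrite mem_enum.
by rewrite /crd linear0.
Qed.

(** The facets come from the dual basis; each equation of the span enters as two inequalities. The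
    condition [free s] stands behind the existential so that [choice] yields a list for every
    [s]. *)
Lemma pos_halfspaces s :
  exists fs, free s -> forall x, pos s x <-> forall f, f \in fs -> 0 <= ev f x.
Proof.
have [an anP] := annihilators <<s>>%VS.
exists ([seq bdual s v | v <- s] ++ an ++ [seq - f | f <- an]) => fr x; split.
  move=> px f; rewrite !mem_cat => /or3P[/mapP[v _ ->]|fa|/mapP[k ka ->]].
  - exact: bdual_ge0.
  - by have /anP/(_ f fa)-> := pos_span px.
  - by have /anP/(_ k ka) := pos_span px; rewrite /ev opp_lfunE => ->; rewrite oppr0.
move=> H; apply: pos_bdual => //; last first.
  by move=> v vs; apply: H; rewrite mem_cat map_f.
apply/anP => f fa; apply/eqP; rewrite eq_le; apply/andP; split; last first.
  by apply: H; rewrite !mem_cat fa orbT.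
have : 0 <= ev (- f) x by apply: H; rewrite !mem_cat map_f ?orbT.
by rewrite /ev opp_lfunE oppr_ge0.
Qed.

(** Only signs and comparisons of linear forms at this interior point of the cone are used, so the
    sum serves in place of the mean. *)
Definition bary s : W := \sum_(v <- s) v.

Lemma pos_bary s : pos s (bary s).
Proof.
suff main r : {subset r <= s} -> pos s (\sum_(v <- r) v) by apply: main.
elim: r => [|v r IH] rs; first by rewrite big_nil; apply: pos0.
rewrite big_cons; apply: posD; first by apply/pos_mem/rs; rewrite mem_head.
by apply: IH => u ur; apply: rs; rewrite inE ur orbT.
Qed.

Lemma bary_ge0_eq0 f s : (forall v, v \in s -> 0 <= ev f v) -> ev f (bary s) <= 0 ->
  forall v, v \in s -> ev f v = 0.
Proof.
move=> H; rewrite /bary ev_sum; elim: s H => // u s IH H; rewrite big_cons => le v.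
have Hs w : w \in s -> 0 <= ev f w by move=> ws; apply: H; rewrite inE ws orbT.
have S0 : 0 <= \sum_(w <- s) ev f w by rewrite big_seq; apply: sumr_ge0.
have u0 : 0 <= ev f u by apply: H; rewrite mem_head.
rewrite inE => /predU1P[->|]; first by apply/eqP; rewrite eq_le u0 andbT; lra.
by apply: IH => //; lra.
Qed.

(** The barycenter decides the side: if [f] is nonpositive on [s] but its sum is not negative, all
    its values are zero. *)
Lemma uncut_bary f s : uncut f s -> 0 <= ev f (bary s) -> forall v, v \in s -> 0 <= ev f v.
Proof.
case=> // H le v vs; have H' u : u \in s -> 0 <= ev (- f) u.
  by move=> us; rewrite /ev opp_lfunE oppr_ge0; apply: H.
have /(_ _ v vs) := bary_ge0_eq0 H'; rewrite /ev !opp_lfunE => E.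
by rewrite -oppr_le0 -[ - _]/(- ev f v) E // oppr_le0.
Qed.

Definition inside s g := forall v, v \in s -> pos g v.

Lemma inside_bary fs s g : (forall x, pos g x <-> forall f, f \in fs -> 0 <= ev f x) ->
  (forall f, f \in fs -> uncut f s) -> pos g (bary s) -> inside s g.
Proof.
move=> H U /H pb v vs; apply/H => f ff.
by apply: uncut_bary vs; [apply: U|apply: pb].
Qed.

(** If a facet form of [g] is nonpositive on [s], it vanishes on the overlap, which spans the same
    space as [s]; so it vanishes on [s] as well. *)
Lemma inside_ov m fs s g : (forall x, pos g x <-> forall f, f \in fs -> 0 <= ev f x) ->
  simp ell m s -> (forall f, f \in fs -> uncut f s) -> ov ell m g s -> inside s g.
Proof.
move=> H S U [r Sr P] v vs; apply/H => f ff; case: (U f ff) => U'; first exact: U'.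
rewrite (_ : ev f v = 0) //.
have Ps u : u \in r -> pos s u by case/P.
apply: (@span_vanish _ _ f r); last by rewrite (simp_span S Sr Ps) memv_span.
move=> u ur; have [/H/(_ f ff) ge pu] := P u ur; apply/eqP; rewrite eq_le ge andbT.
exact: pos_le0 pu.
Qed.

Lemma simp_ov m s : simp ell m s -> ov ell m s s.
Proof. by move=> S; exists s => // v vs; split; apply: pos_mem. Qed.

Lemma inside_simp_ov m s g1 g2 : simp ell m s -> inside s g1 -> inside s g2 -> ov ell m g1 g2.
Proof. by move=> S i1 i2; exists s => // v vs; split; [apply: i1|apply: i2]. Qed.

Lemma nonov_eq m l s1 s2 : nonov ell m l -> s1 \in l -> s2 \in l -> ov ell m s1 s2 -> s1 = s2.
Proof.
move=> N i1 i2 O; apply: contrapT => ne; apply: (N s1 s2 (rem s2 (rem s1 l))) O.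
apply: perm_trans (perm_to_rem i1) _; rewrite perm_cons perm_to_rem //.
by move: i2; rewrite (perm_mem (perm_to_rem i1)) inE => /predU1P[e|//]; case: ne.
Qed.

Lemma nonov_count m l (P : pred (seq W)) s : nonov ell m l -> s \in l -> P s ->
  (forall s1 s2, P s1 -> P s2 -> ov ell m s1 s2) -> count P l = 1%N.
Proof.
move=> N sl Ps H; have p := perm_to_rem sl; rewrite (permP p) /= Ps.
apply/eqP; rewrite eqSS -leqn0 leqNgt -has_count; apply/hasPn => s' s'l; apply/negP => Ps'.
have p' := perm_to_rem s'l.
apply: (N s s' (rem s' (rem s l))); last exact: H.
by apply: perm_trans p _; rewrite perm_cons.
Qed.

Definition insideb s g := `[< inside s g >].

(* To see that g is covered, cut it along the facets of all members of l: a piece then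
   lies in any member of l that contains its barycenter. *)
Lemma tri_inside m l C g : tri ell m l C -> simp ell m g -> (forall x, pos g x -> C x) ->
    (forall s, s \in l -> ov ell m g s -> inside s g) ->
  tri ell m [seq s <- l | insideb s g] (pos g).
Proof.
move=> [S N CE] Sg gC H; split.
- by move=> s; rewrite mem_filter => /andP[_]; apply: S.
- exact: nonov_filter.
move=> x; split=> [px|[s]]; last first.
  by rewrite mem_filter => /andP[/asboolP i sl]; apply: pos_sub.
have [hs hsP] := choice pos_halfspaces.
have [bs [_ D C'] U] := cut_functionals (flatten [seq hs s | s <- l]) Sg.
have [b bl pb] := C' x px; have [Sb ib] := D b bl.
have /gC/CE[s sl ps] : pos g (bary b) by apply: pos_sub (pos_bary b).
have fs : free s by case: (S s sl).
have ibs : inside b s.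
  apply: (inside_bary (hsP s fs)) ps => f fh; apply: U bl _.
  by apply/flatten_mapP; exists s.
exists s; last exact: pos_sub pb.
rewrite mem_filter sl andbT; apply/asboolP; apply: H => //.
exact: inside_simp_ov Sb ib ibs.
Qed.

Lemma refine m l fs : (forall s, s \in l -> simp ell m s) ->
  exists2 l', eqv l l' & forall s f, s \in l' -> f \in fs -> uncut f s.
Proof.
elim: l => [|s l IH] H; first by exists [::].
have [l1 [e1 _ _] U1] := cut_functionals fs (H s (mem_head _ _)).
have [s' sl|l2 e2 U2] := IH; first by apply: H; rewrite inE sl orbT.
exists (l1 ++ l2); first exact: (@eqv_cat _ _ [:: s] _ l).
by move=> s' f; rewrite mem_cat => /orP[sl|sl] ff; [apply: U1|apply: U2].
Qed.

Lemma eqv_tilings m l1 l2 C :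
    (forall s l, simp ell m s -> tri ell m l (pos s) -> eqv l [:: s]) ->
  tri ell m l1 C -> tri ell m l2 C -> eqv l1 l2.
Proof.
move=> IH T1 T2; have [hs hsP] := choice pos_halfspaces.
have [S1 N1 C1] := T1; have [S2 _ _] := T2.
have [l3 e3 U3] := refine (flatten [seq hs s | s <- l1]) S2.
have T3 := (eqv_tri ell m C e3).1 T2; have [S3 N3 C3] := T3.
have in3 s : s \in l3 -> exists2 g, g \in l1 & inside s g.
  move=> sl; have /C1[g gl pg] : C (bary s) by apply/C3; exists s => //; apply: pos_bary.
  exists g => //; have fg : free g by case: (S1 g gl).
  apply: (inside_bary (hsP g fg)) pg => f fh; apply: U3 sl _.
  by apply/flatten_mapP; exists g.
apply: eqv_sym; apply: eqv_trans e3 _.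
have p : perm_eq (flatten [seq [seq s <- l3 | insideb s g] | g <- l1]) l3.
  apply: perm_partition => s sl; have [g gl i] := in3 s sl.
  apply: (nonov_count N1 gl); first exact/asboolP.
  by move=> g1 g2 /asboolP i1 /asboolP i2; apply: inside_simp_ov (S3 s sl) i1 i2.
apply: eqv_trans (eqv_sym (eqv_perm p)) _.
rewrite -[X in eqv _ X](flatten_seq1 l1); apply: eqv_flatten => g gl.
apply: IH; first exact: S1.
apply: tri_inside T3 (S1 g gl) _ _; first by move=> x px; apply/C1; exists g.
(* A piece overlapping [g] lies in some member [g']; then [g'] overlaps [g] and must equal it. *)
move=> s sl [r Sr P]; have [g' gl' i'] := in3 s sl.
suff -> : g = g' by [].
apply: nonov_eq N1 gl gl' _; exists r => // v /P[pg ps]; split=> //.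
exact: pos_sub ps.
Qed.

End Tilings.

(** * Columns *)

Section Columns.
Context {R : realFieldType} {W : vectType R}.
Notation dual := 'Hom(W, R^o).
Implicit Types (s g pre G r : seq W) (l : seq (seq W)) (f h k : dual).
Implicit Types (u v w x y z : W) (t : R) (m : nat) (fs : seq dual).
Variable ell : dual.

Lemma simp_free m s : simp ell m s -> free s.
Proof. by case. Qed.

Lemma free_by_span s1 s2 : free s2 -> size s1 = size s2 ->
  (forall v, v \in s2 -> v \in <<s1>>%VS) -> free s1.
Proof.
move=> f2 E /span_subvP/dimvS; move: f2; rewrite /free => /eqP-> le.
by rewrite eqn_leq dim_span E.
Qed.

Variables (e : W) (phi : dual).
Hypothesis (ell_e : ev ell e = 0) (phi_e : ev phi e = 1).

(** Projection along [e] onto the kernel of [phi], where all bases are placed; [phi] then reads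
    heights along [e], and [ev ell e = 0] keeps projected points at height 1 for [ell]. *)
Definition proj x := x - ev phi x *: e.

Lemma ev_proj x : ev phi (proj x) = 0.
Proof. by rewrite evB evZ phi_e mulr1 subrr. Qed.

Lemma ell_proj x : ev ell (proj x) = ev ell x.
Proof. by rewrite evB evZ ell_e mulr0 subr0. Qed.

Lemma ell_lift h x : ev ell (lift e h x) = ev ell x.
Proof. by rewrite evD evZ ell_e mulr0 addr0. Qed.

Lemma proj_lift h x : ev phi x = 0 -> proj (lift e h x) = x.
Proof. by move=> x0; rewrite /proj /lift evD evZ phi_e x0 add0r mulr1 addrK. Qed.

Lemma phi_lift h x : ev phi x = 0 -> ev phi (lift e h x) = ev h x.
Proof. by move=> x0; rewrite evD evZ phi_e x0 add0r mulr1. Qed.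

Lemma proj_comb (a : R) x y : proj (a *: x + y) = a *: proj x + proj y.
Proof. by rewrite /proj evD evZ; vector_field. Qed.

Definition horizontal s := forall v, v \in s -> ev phi v = 0.

(** The two lifts of [v] differ by a nonzero multiple of [e]; once [e] is in the span, every lift
    can be brought back down to the base. *)
Lemma simp_lift m v g h h' : simp ell m (v :: g) -> horizontal (v :: g) ->
  ev h v <> ev h' v -> simp ell m.+1 [:: lift e h v, lift e h' v & map (lift e h) g].
Proof.
move=> [fr sz el] hor ne.
have fe : free [:: e, v & g].
  rewrite free_cons fr andbT; apply/negP => /(span_vanish hor) E.
  by move/eqP: phi_e; rewrite E eq_sym oner_eq0.
split; last 1 first.
- move=> u; rewrite !inE => /or3P[/eqP->|/eqP->|/mapP[x xg ->]]; rewrite ell_lift el //.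
  + by rewrite mem_head.
  + by rewrite mem_head.
  + by rewrite inE xg orbT.
- apply: (free_by_span fe); first by rewrite /= size_map.
  set V := <<_>>%VS.
  have V1 : lift e h v \in V by apply: memv_span; rewrite mem_head.
  have V2 : lift e h' v \in V by apply: memv_span; rewrite !inE eqxx orbT.
  have n0 : ev h' v - ev h v != 0 by rewrite subr_eq0; apply/eqP => E; apply: ne.
  have Ve : e \in V.
    have -> : e = (ev h' v - ev h v)^-1 *: (lift e h' v - lift e h v).
      by rewrite /lift; vector_field.
    by apply: memvZ; apply: memvB.
  have down x : lift e h x \in V -> x \in V.
    move=> xV; have -> : x = lift e h x - ev h x *: e by rewrite /lift addrK.
    by apply: memvB => //; apply: memvZ.
  move=> u; rewrite !inE => /or3P[/eqP->//|/eqP->|ug]; apply: down => //.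
  by apply: memv_span; rewrite !inE map_f ?orbT.
- by rewrite /= size_map -sz.
Qed.

(* A column (b0, B, h, h') stands for the simplex over the base b0 :: B that lies
   between the graphs of h and h', where h and h' differ only at b0. *)
Definition col := (W * seq W * dual * dual)%type.
Definition base (c : col) : seq W := c.1.1.1 :: c.1.1.2.
Definition low (c : col) : dual := c.1.2.
Definition high (c : col) : dual := c.2.
Definition colx (c : col) : seq W :=
  [:: lift e (low c) c.1.1.1, lift e (high c) c.1.1.1 & map (lift e (low c)) c.1.1.2].

Definition wf m (c : col) :=
  [/\ simp ell m (base c), horizontal (base c), ev (low c) c.1.1.1 < ev (high c) c.1.1.1 &
    forall v, v \in c.1.1.2 -> ev (low c) v = ev (high c) v].

Lemma stair_col m c : wf m c -> stair e (low c) (high c) [::] (base c) = [:: colx c].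
Proof. by case=> _ _ lt E; rewrite /= lt stair_flat. Qed.

Lemma wf_below m c : wf m c -> below (base c) (low c) (high c).
Proof. by case=> _ _ lt E v; rewrite inE => /predU1P[->|/E->//]; apply: ltW. Qed.

Lemma col_in m c u (eta : R) : wf m c -> pos (base c) u ->
  ev (low c) u <= eta -> eta <= ev (high c) u -> pos (colx c) (u + eta *: e).
Proof.
case: c => [[[b0 B] h] h'] [/= _ _ lt E] /pos_cons[a [u' [a0 pu' ->]]].
rewrite /colx /low /high /= in lt E *.
have Eu : ev h u' = ev h' u'.
  have [x0|] := pselect (ev h u' - ev h' u' = 0); first by lra.
  have H v : v \in B -> ev (h - h') v = 0 by move=> /E vE; rewrite ev_subf vE subrr.
  by rewrite -ev_subf (span_vanish H (pos_span pu')).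
rewrite !evD !evZ -Eu => le1 le2.
have pl : pos (map (lift e h) B) (u' + ev h u' *: e).
  elim: pu' {Eu le1 le2} => [|v c z vB c0 _ IH].
    by rewrite ev0 scale0r addr0; apply: pos0.
  have -> : c *: v + z + ev h (c *: v + z) *: e = c *: lift e h v + (z + ev h z *: e).
    by rewrite /lift evD evZ; vector_field.
  by apply: pos_step => //; apply: map_f.
pose D := ev h' b0 - ev h b0.
have D0 : 0 < D by rewrite subr_gt0.
have D1 : D != 0 by rewrite gt_eqF.
(* The weight of the upper lift of [b0]: the height above the lower graph, measured in units of the
   gap [D] at [b0], the only vertex with a gap. *)
pose q := (eta - ev h u' - a * ev h b0) / D.
have q0 : 0 <= q by apply: divr_ge0; lra.
have qa : q <= a by rewrite ler_pdivrMr // /D; lra.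
have -> : a *: b0 + u' + eta *: e =
    (a - q) *: lift e h b0 + (q *: lift e h' b0 + (u' + ev h u' *: e)).
  have -> : eta = q * D + ev h u' + a * ev h b0 by rewrite /q divfK //; ring.
  by rewrite /lift /D; vector_field.
apply: pos_step; [by rewrite mem_head|by lra|].
apply: pos_step => //; first by rewrite !inE eqxx orbT.
by do 2!apply: pos_behead.
Qed.

Lemma col_out m c x : wf m c -> pos (colx c) x ->
  [/\ pos (base c) (proj x), ev (low c) (proj x) <= ev phi x &
    ev phi x <= ev (high c) (proj x)].
Proof.
move=> w; have [_ hor lt E] := w; elim=> [|v a y vc a0 _ [IH1 IH2 IH3]].
  by rewrite /proj ev0 scale0r subr0 !ev0; split=> //; apply: pos0.
have evp k : ev k (proj (a *: v + y)) = a * ev k (proj v) + ev k (proj y).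
  by rewrite proj_comb evD evZ.
rewrite !evp (evD phi (a *: v) y) (evZ phi a v).
suff [p1 p2 p3] : [/\ pos (base c) (proj v), ev (low c) (proj v) <= ev phi v &
    ev phi v <= ev (high c) (proj v)].
  split; [|by apply: lerD => //; apply: ler_wpM2l..].
  by rewrite proj_comb; apply: posD => //; apply: posZ.
have key k u : u \in base c -> proj (lift e k u) = u /\ ev phi (lift e k u) = ev k u.
  by move=> /hor u0; rewrite proj_lift // phi_lift.
have b0 : c.1.1.1 \in base c by rewrite mem_head.
move: vc; rewrite !inE => /or3P[/eqP->|/eqP->|/mapP[u uB ->]].
- have [-> ->] := key (low c) _ b0.
  by split=> //; [apply: pos_mem|apply: ltW].
- have [-> ->] := key (high c) _ b0.
  by split=> //; [apply: pos_mem|apply: ltW].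
- have ub : u \in base c by rewrite inE uB orbT.
  by have [-> ->] := key (low c) _ ub; rewrite E //; split=> //; apply: pos_mem.
Qed.

(** The facets opposite [b] and opposite [a] have the same projection, since [b] lies above [a].
    Interpolating [phi] on these two facets gives the lower and the upper height. *)
Lemma base_proj m (a b : W) G (c : R) :
    simp ell m.+1 [:: a, b & G] -> 0 < c -> b = a + c *: e ->
  exists K : col, wf m K /\ perm_eq [:: a, b & G] (colx K).
Proof.
move=> [fr sz el] c0 bE.
have n0 : c != 0 by rewrite gt_eqF.
pose B := map proj (a :: G).
have fe : free (e :: B).
  apply: (free_by_span fr); first by rewrite /= size_map.
  set V := <<_>>%VS.
  have Ve : e \in V by apply: memv_span; rewrite mem_head.
  have VB x : x \in a :: G -> x \in V.
    move=> xa; have -> : x = proj x + ev phi x *: e by rewrite /proj subrK.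
    by apply: memvD; [apply: memv_span; rewrite inE map_f ?orbT|apply: memvZ].
  move=> v; rewrite !inE => /or3P[/eqP->|/eqP->|vG].
  - by apply: VB; rewrite mem_head.
  - by rewrite bE; apply: memvD; [apply: VB; rewrite mem_head|apply: memvZ].
  - by apply: VB; rewrite inE vG orbT.
have fB : free B by move: fe; rewrite free_cons => /andP[].
have sB : size (map (ev phi) (a :: G)) = size B by rewrite !size_map.
have [h hE] := dual_interp_seq fB sB.
have sB' : size (ev phi b :: map (ev phi) G) = size B by rewrite /= !size_map.
have [h' hE'] := dual_interp_seq fB sB'.
have {}hE v : v \in a :: G -> ev h (proj v) = ev phi v.
  by move: v; apply/eq_in_map; rewrite -hE /= -!map_comp.
move: hE'; rewrite /= -map_comp => -[ha' /eq_in_map hG'].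
exists (proj a, map proj G, h, h'); split.
  split; rewrite /base /low /high /=.
  - split=> //; first by rewrite /= size_map; case: sz.
    move=> v; rewrite inE => /predU1P[->|/mapP[u uG ->]]; rewrite ell_proj el //.
      by rewrite mem_head.
    by rewrite !inE uG !orbT.
  - move=> v; rewrite inE => /predU1P[->|/mapP[u uG ->]]; exact: ev_proj.
  - by rewrite ha' hE ?mem_head // bE evD evZ phi_e; lra.
  - by move=> v /mapP[u uG ->]; rewrite hE ?inE ?uG ?orbT //; apply/esym/hG'.
rewrite /colx /low /high /=.
have la x : ev h (proj x) = ev phi x -> lift e h (proj x) = x.
  by rewrite /lift => ->; rewrite /proj subrK.
rewrite la ?hE ?mem_head //.
have -> : lift e h' (proj a) = b.
  by rewrite /lift ha' bE evD evZ phi_e /proj; vector_field.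
rewrite -map_comp (_ : map _ G = G) //.
by rewrite -[RHS]map_id; apply/eq_in_map => v vG /=; rewrite la // hE // inE vG orbT.
Qed.

(* Splitting an edge joining two vertices with coefficients of the same sign in
   e = \sum a_i v_i removes one coefficient, so in the end e is parallel to an edge. *)
Lemma to_columns m (zs : seq (R * W)) :
    simp ell m.+1 (map snd zs) -> \sum_(z <- zs) z.1 *: z.2 = e ->
  exists cs : seq col, (forall c : col, c \in cs -> wf m c) /\ eqv [:: map snd zs] (map colx cs).
Proof.
have [k] := ubnP (count (fun z : R * W => z.1 != 0) zs); elim: k zs => // k IH zs ck S sE.
have merge (i j : R * W) (zs' : seq (R * W)) : perm_eq zs [:: i, j & zs'] -> 0 < i.1 * j.1 ->
  exists cs : seq col, (forall c : col, c \in cs -> wf m c) /\ eqv [:: map snd zs] (map colx cs).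
  case: i => a x; case: j => b y p ab /=.
  have a0 : a != 0 by apply/eqP => E; move: ab; rewrite /= E mul0r ltxx.
  have b0 : b != 0 by apply/eqP => E; move: ab; rewrite /= E mulr0 ltxx.
  have s0 : a + b != 0 by apply/eqP => /= E; move: ab; rewrite /= (_ : b = - a); [nra|lra].
  (* Chosen so that [(a + b) *: w = a *: x + b *: y]: in each half [w] takes the coefficient [a + b]
     and the remaining endpoint takes 0. *)
  pose t := b / (a + b).
  have t0 : 0 < t.
    have -> : t = (b * (a + b)) / ((a + b) * (a + b)) by rewrite /t; field.
    by apply: divr_gt0 => /=; move: ab => /=; nra.
  have t1 : t < 1.
    have : 0 < 1 - t; last by lra.
    have -> : 1 - t = (a * (a + b)) / ((a + b) * (a + b)) by rewrite /t; field.
    by apply: divr_gt0 => /=; move: ab => /=; nra.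
  pose w := (1 - t) *: x + t *: y.
  have wE : (a + b) *: w = a *: x + b *: y by rewrite /w /t; vector_field.
  have pS : perm_eq (map snd zs) [:: x, y & map snd zs'] by apply: perm_map p.
  have S' := simp_perm pS S.
  have [S1 S2] := simp_split t0 t1 (erefl w) S'.
  have cE : (count (fun z : R * W => z.1 != 0) zs = (count (fun z : R * W => z.1 != 0) zs').+2).
    by rewrite (permP p) /= a0 b0.
  rewrite cE in ck; rewrite (perm_big _ p) !big_cons /= in sE.
  have [cs1 [w1 e1]] : exists cs : seq col, (forall c : col, c \in cs -> wf m c) /\
      eqv [:: [:: w, y & map snd zs']] (map colx cs).
    apply: (IH ((a + b, w) :: (0, y) :: zs')) => //.
      by rewrite /= s0 eqxx add0n add1n -ltnS.
    by rewrite !big_cons /= wE scale0r add0r -addrA.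
  have [cs2 [w2 e2]] : exists cs : seq col, (forall c : col, c \in cs -> wf m c) /\
      eqv [:: [:: x, w & map snd zs']] (map colx cs).
    apply: (IH ((0, x) :: (a + b, w) :: zs')) => //.
      by rewrite /= s0 eqxx add0n add1n -ltnS.
    by rewrite !big_cons /= wE scale0r add0r -addrA.
  exists (cs1 ++ cs2); split.
    by move=> c; rewrite mem_cat => /orP[/w1|/w2].
  rewrite map_cat; apply: eqv_trans (eqv_vertices _ pS) _.
  apply: eqv_trans (eqv_split1 _ t0 t1 (erefl w)) _.
  exact: (@eqv_cat _ _ [:: _] _ [:: _]).
(* The coefficients sum to zero because [ev ell e = 0], and not all vanish because [e] is nonzero.
   So unless two share a strict sign and [merge] applies, exactly two are nonzero and opposite,
   which makes [e] a multiple of an edge. *)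
pose P := [seq z <- zs | 0 < z.1].
pose N := [seq z <- zs | z.1 < 0].
pose Z := [seq z <- zs | z.1 == 0].
have p : perm_eq zs (P ++ N ++ Z).
  rewrite /P /N /Z; clear; elim: zs => //= i zs IH.
  apply/permP => q; move/permP/(_ q): IH.
  by case: (ltrgt0P i.1) => _; rewrite /= !count_cat /= => ->; rewrite ?count_cat; count_lia.
have Ps (z : R * W) : z \in P -> 0 < z.1 by rewrite mem_filter => /andP[].
have Ns (z : R * W) : z \in N -> z.1 < 0 by rewrite mem_filter => /andP[].
have Zs (z : R * W) : z \in Z -> z.1 = 0 by rewrite mem_filter => /andP[/eqP].
have el (z : R * W) : z \in zs -> ev ell z.2 = 1.
  by case: S => _ _ H zz; apply: H; apply: map_f.
have sum0 : \sum_(z <- zs) z.1 = 0.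
  move: ell_e; rewrite -sE ev_sum => E; rewrite -[RHS]E; apply: eq_big_seq => z /el.
  by rewrite evZ => ->; rewrite mulr1.
have sZ : \sum_(z <- Z) z.1 = 0 by rewrite big_seq big1 // => z /Zs.
have sZ' : \sum_(z <- Z) z.1 *: z.2 = 0.
  by rewrite big_seq big1 // => z /Zs->; rewrite scale0r.
clearbody P N Z.
case: P => [|i [|j P]] in p Ps *; last first.
- by apply: merge p _; apply: mulr_gt0; apply: Ps; rewrite !inE eqxx ?orbT.
- case: N => [|i' [|j' N]] in p Ns *; last first.
  + apply: (@merge i' j' ([:: i] ++ N ++ Z)); first by apply: perm_trans p _; solve_perm.
    have := Ns i' (mem_head _ _); have := Ns j' _; rewrite !inE eqxx orbT => /(_ isT); nra.
  + move: sum0 sE; rewrite !(perm_big _ p) /= !big_cons sZ sZ' !addr0 => sum0 sE.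
    have i0 := Ps i (mem_head _ _).
    have S2 : simp ell m.+1 [:: i'.2, i.2 & map snd Z].
      have p2 : perm_eq zs [:: i', i & Z] by apply: perm_trans p _; solve_perm.
      exact: simp_perm (perm_map snd p2) S.
    have i1 : 0 < (i.1)^-1 by rewrite invr_gt0.
    have bE : i.2 = i'.2 + (i.1)^-1 *: e.
      have n0 : i.1 != 0 by rewrite gt_eqF.
      have E : i'.1 = - i.1 by lra.
      by rewrite -sE E; vector_field.
    have [K [wK pK]] := base_proj S2 i1 bE.
    exists [:: K]; split; first by move=> c; rewrite inE => /eqP->.
    apply: eqv_cons => //; apply: perm_trans pK.
    by apply: perm_trans (perm_map snd p) _; solve_perm.
  + move: sum0; rewrite (perm_big _ p) /= big_cons sZ addr0 => E.
    by have := Ps i (mem_head _ _); rewrite E ltxx.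
- case: N => [|i' N] in p Ns *.
    move: sE; rewrite (perm_big _ p) /= sZ' => E.
    by move: phi_e; rewrite -E ev0 => /eqP; rewrite eq_sym oner_eq0.
  move: sum0; rewrite (perm_big _ p) /= big_cons big_cat /= sZ addr0 => E.
  have := Ns i' (mem_head _ _).
  suff : \sum_(z <- N) z.1 <= 0 by lra.
  rewrite big_seq; apply: sumr_le0 => z zN; apply/ltW/Ns.
  by rewrite inE zN orbT.
Qed.

Lemma below_bary (h k : dual) g : uncut (h - k) g -> ev h (bary g) <= ev k (bary g) ->
  below g h k.
Proof.
move=> U le v vg; have U' := uncut_opp U.
have := uncut_bary U' (_ : 0 <= ev (k - h) (bary g)) vg.
by rewrite !ev_subf !subr_ge0; apply.
Qed.

Lemma eq_bary (h k : dual) g : uncut (h - k) g -> ev h (bary g) = ev k (bary g) ->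
  forall v, v \in g -> ev h v = ev k v.
Proof.
move=> U E v vg; apply/eqP; rewrite eq_le.
by rewrite (below_bary U _ vg) ?(below_bary (uncut_opp U) _ vg) // E.
Qed.

(* Since all height functions are comparable on g, their values at the barycenter
   determine the order of the slabs. *)
Lemma stair_stack (T : eqType) (lo hi : T -> dual) (D : seq T) (hl hu : dual)
    (HS : dual -> Prop) g :
    (forall h k, HS h -> HS k -> uncut (h - k) g) -> HS hl -> HS hu ->
    (forall d, d \in D -> [/\ HS (lo d), HS (hi d), ev hl (bary g) <= ev (lo d) (bary g),
       ev (lo d) (bary g) < ev (hi d) (bary g) & ev (hi d) (bary g) <= ev hu (bary g)]) ->
    ev hl (bary g) <= ev hu (bary g) ->
    (forall d1 d2 D', perm_eq D [:: d1, d2 & D'] ->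
       ev (hi d1) (bary g) <= ev (lo d2) (bary g) \/ ev (hi d2) (bary g) <= ev (lo d1) (bary g)) ->
    (forall eta : R, ev hl (bary g) < eta -> eta < ev hu (bary g) ->
       exists2 d, d \in D & ev (lo d) (bary g) <= eta <= ev (hi d) (bary g)) ->
  eqv (flatten [seq stair e (lo d) (hi d) [::] g | d <- D]) (stair e hl hu [::] g).
Proof.
move=> U; have [k] := ubnP (size D); elim: k D hl => // k IH D hl sD Hl Hu HD.
rewrite le_eqVlt => /predU1P[E|lt] HO HC.
  case: D HD {sD HO HC} => [|d D] HD; last first.
    by have [] := HD d (mem_head _ _); rewrite E => _ _ *; lra.
  by rewrite stair_flat //; apply: eq_bary => //; apply: U.
have Dn : D != [::].
  have l1 : ev hl (bary g) < (ev hl (bary g) + ev hu (bary g)) / 2 by lra.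
  have l2 : (ev hl (bary g) + ev hu (bary g)) / 2 < ev hu (bary g) by lra.
  by have [d] := HC _ l1 l2; case: (D).
have [d dD dmin] := seq_min (fun d => ev (lo d) (bary g)) Dn.
have [H1 H2 le1 lt12 le2] := HD d dD.
(* Otherwise the midpoint between [hl] and the lowest bottom is a height that no slab reaches. *)
have E : ev hl (bary g) = ev (lo d) (bary g).
  apply/eqP; rewrite eq_le le1 leNgt; apply/negP => lt1.
  have l1 : ev hl (bary g) < (ev hl (bary g) + ev (lo d) (bary g)) / 2 by lra.
  have l2 : (ev hl (bary g) + ev (lo d) (bary g)) / 2 < ev hu (bary g) by lra.
  have [d' /dmin m1 /andP[m2 _]] := HC _ l1 l2; lra.
have p := perm_to_rem dD; set D' := rem d D in p.
apply: eqv_trans (eqv_perm (perm_flatten (perm_map _ p))) _ => /=.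
rewrite (@stair_eq _ _ e hl hu (lo d) hu) //; last first.
  by apply: eq_bary => //; apply: U.
(* The lowest slab is peeled off; the induction continues with [hi d] as the new bottom. *)
apply: eqv_trans (stair_cat e [::] (h2 := (hi d)) _ _).
- apply: eqv_cat => //; apply: IH => //.
  + by rewrite -ltnS; apply: leq_trans _ sD; rewrite (perm_size p).
  + move=> d' d'D; have d'D0 : d' \in D by rewrite (perm_mem p) inE d'D orbT.
    have [H1' H2' le1' lt12' le2'] := HD d' d'D0; split=> //.
    have p' : perm_eq D [:: d, d' & rem d' D'].
      by apply: perm_trans p _; rewrite perm_cons perm_to_rem.
    by case: (HO _ _ _ p') => //; have := dmin d' d'D0; lra.
  + move=> d1 d2 D2 p2; apply: (HO d1 d2 (d :: D2)); apply: perm_trans p _.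
    by apply: (@perm_trans _ [:: d, d1, d2 & D2]); [rewrite perm_cons|solve_perm].
  + move=> eta lt1 lt2; have lt1' : ev hl (bary g) < eta by lra.
    have [d' d'D /andP[m1 m2]] := HC eta lt1' lt2.
    exists d'; last by rewrite m1.
    by move: d'D; rewrite (perm_mem p) inE => /predU1P[E'|//]; rewrite E' in m2; lra.
- by apply: below_bary; [apply: U|apply: ltW].
- by apply: below_bary; [apply: U|].
Qed.

End Columns.

(** * Tilings of one simplex by induction on the dimension *)

Section TileStep.
Context {R : realFieldType} {W : vectType R}.
Notation dual := 'Hom(W, R^o).
Implicit Types (s g pre G r : seq W) (l : seq (seq W)) (f h k : dual).
Implicit Types (u v w x y z : W) (t : R) (m : nat) (fs : seq dual).
Notation col := (@col R W).
Variable ell : dual.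

Lemma tri1 m s : simp ell m s -> tri ell m [:: s] (pos s).
Proof.
move=> S; split; first by move=> s'; rewrite inE => /eqP->.
  by move=> s1 s2 l' /perm_size.
by move=> x; split=> [px|[s']]; [exists s; rewrite ?mem_head|rewrite inE => /eqP->].
Qed.

Section Layers.
Variables (e : W) (phi : dual).
Hypothesis (ell_e : ev ell e = 0) (phi_e : ev phi e = 1).
Local Notation wf := (@wf R W ell phi).
Local Notation colx := (@colx R W e).

(** The gap is nonnegative on [g]; if it did not show at the barycenter it would vanish on [g],
    hence on the span of the base, contrary to the gap at the first base vertex. *)
Lemma wf_lt m g (K : col) : wf m K -> simp ell m g -> inside g (base K) ->
  ev (low K) (bary g) < ev (high K) (bary g).
Proof.
move=> wK Sg i; have [SK _ lt _] := wK; rewrite ltNge; apply/negP => le.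
have H v : v \in g -> 0 <= ev (high K - low K) v.
  move=> /i; apply: pos_ge0 => u /(wf_below wK); by rewrite ev_subf subr_ge0.
have E v : v \in g -> ev (high K - low K) v = 0.
  by apply: (bary_ge0_eq0 H); rewrite ev_subf subr_le0.
have : ev (high K - low K) K.1.1.1 = 0.
  apply: span_vanish E _; rewrite (simp_span SK Sg i) memv_span //.
  by rewrite mem_head.
by rewrite ev_subf; lra.
Qed.

(** The common simplex is one of the prism between [k] and [k'] over [g], raising a vertex where the
    two heights differ. *)
Lemma layers_ov m g (K1 K2 : col) k k' : simp ell m g -> wf m K1 -> wf m K2 ->
    inside g (base K1) -> inside g (base K2) ->
    below g (low K1) k -> below g (low K2) k -> below g k k' ->
    below g k' (high K1) -> below g k' (high K2) -> ev k (bary g) < ev k' (bary g) ->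
  ov ell m.+1 (colx K1) (colx K2).
Proof.
move=> Sg w1 w2 i1 i2 l1 l2 kk u1 u2 lt.
have [v vg ne] : exists2 v, v \in g & ev k v <> ev k' v.
  apply: contrapT => N; suff : ev (k - k') (bary g) = 0 by rewrite ev_subf; lra.
  apply: (@span_vanish _ _ _ g); last exact/pos_span/pos_bary.
  move=> v vg; rewrite ev_subf; apply/eqP; rewrite subr_eq0; apply/eqP.
  by apply: contrapT => ne; apply: N; exists v.
have hor : horizontal phi g.
  move=> u /i1/pos_span; apply: span_vanish; by case: w1.
have p := perm_to_rem vg.
exists [:: lift e k v, lift e k' v & map (lift e k) (rem v g)].
  apply: (simp_lift ell_e phi_e _ _ ne); first exact: simp_perm p Sg.
  by move=> u; rewrite -(perm_mem p); apply: hor.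
have in1 u : u \in g -> pos (colx K1) (lift e k u) /\ pos (colx K2) (lift e k u).
  move=> ug; split; apply: col_in; eauto.
  - exact: le_trans (kk u ug) (u1 u ug).
  - exact: le_trans (kk u ug) (u2 u ug).
move=> u; rewrite !inE => /or3P[/eqP->|/eqP->|/mapP[x xg ->]]; first exact: in1.
  split; apply: col_in; eauto.
  - exact: le_trans (l1 v vg) (kk v vg).
  - exact: le_trans (l2 v vg) (kk v vg).
by apply: in1; apply: mem_rem xg.
Qed.

(** Otherwise, at the barycenter, the larger lower height is below the smaller upper height; the
    comparison extends weakly to all of [g], and the region between them lies in both columns. *)
Lemma layers_ordered m g (K1 K2 : col) (HS : dual -> Prop) :
    (forall h k, HS h -> HS k -> uncut (h - k) g) ->
    HS (low K1) -> HS (low K2) -> HS (high K1) -> HS (high K2) ->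
    simp ell m g -> wf m K1 -> wf m K2 -> inside g (base K1) -> inside g (base K2) ->
    ~ ov ell m.+1 (colx K1) (colx K2) ->
  ev (high K1) (bary g) <= ev (low K2) (bary g) \/ ev (high K2) (bary g) <= ev (low K1) (bary g).
Proof.
move=> U L1 L2 H1 H2 Sg w1 w2 i1 i2 N.
have lt1 := wf_lt w1 Sg i1; have lt2 := wf_lt w2 Sg i2.
have [|lt12] := leP (ev (high K1) (bary g)) (ev (low K2) (bary g)); first by left.
have [|lt21] := leP (ev (high K2) (bary g)) (ev (low K1) (bary g)); first by right.
case: N.
have B h k : HS h -> HS k -> ev h (bary g) <= ev k (bary g) -> below g h k.
  by move=> Hh Hk; apply: below_bary; apply: U.
have [k [Hk [k1 k2 kE]]] : exists k, HS k /\ [/\ ev (low K1) (bary g) <= ev k (bary g),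
    ev (low K2) (bary g) <= ev k (bary g) & k = low K1 \/ k = low K2].
  have [le|le] := leP (ev (low K1) (bary g)) (ev (low K2) (bary g)).
    by exists (low K2); do !split=> //; right.
  by exists (low K1); do !split=> //; [apply: ltW|left].
have [k' [Hk' [k1' k2' kE']]] : exists k, HS k /\ [/\ ev k (bary g) <= ev (high K1) (bary g),
    ev k (bary g) <= ev (high K2) (bary g) & k = high K1 \/ k = high K2].
  have [le|le] := leP (ev (high K1) (bary g)) (ev (high K2) (bary g)).
    by exists (high K1); do !split=> //; left.
  by exists (high K2); do !split=> //; [apply: ltW|right].
have lt : ev k (bary g) < ev k' (bary g) by case: kE => ->; case: kE' => ->.
apply: (layers_ov (k := k) (k' := k')) (lt) => //; apply: B => //.
exact: ltW lt.
Qed.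
End Layers.

Lemma tile_step m l (s0 s1 : W) G :
    (forall s l, simp ell m s -> tri ell m l (pos s) -> eqv l [:: s]) ->
    simp ell m.+1 [:: s0, s1 & G] -> tri ell m.+1 l (pos [:: s0, s1 & G]) ->
  eqv l [:: [:: s0, s1 & G]].
Proof.
set s := [:: s0, s1 & G] => IH S T.
have [fs0 _ el] := S; pose e := s1 - s0.
have ell_e : ev ell e = 0 by rewrite evB !el ?subrr // !inE eqxx ?orbT.
have e0 : e != 0.
  have := free_uniq fs0; rewrite /= inE negb_or subr_eq0 eq_sym.
  by case: eqP => // ->.
have [phi phiE] : exists f, forall v, v \in [:: e] -> ev f v = 1.
  by apply: (dual_interp (fun=> 1)); rewrite seq1_free.
have phi_e : ev phi e = 1 by apply: phiE; rewrite mem_head.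
have s1E : s1 = s0 + 1 *: e by rewrite scale1r addrC subrK.
have [KT [wT pT]] := base_proj ell_e phi_e S ltr01 s1E.
have [S1 N1 C1] := T.
have colsP s' : exists cs : seq col, s' \in l ->
    (forall c : col, c \in cs -> wf ell phi m c) /\ eqv [:: s'] (map (colx e) cs).
  have [sl|] := boolP (s' \in l); last by exists [::].
  (* The coefficients of [e] on the vertices of [s']; they represent [e] because [s'] has the same
     span as [s]. *)
  pose zs := [seq (ev (bdual s' v) e, v) | v <- s'].
  have zE : map snd zs = s' by rewrite -map_comp map_id.
  have Ss := S1 s' sl; have f' := simp_free Ss.
  have Sz : simp ell m.+1 (map snd zs) by rewrite zE.
  have sumz : \sum_(z <- zs) z.1 *: z.2 = e.
    rewrite big_map -span_bdual // (simp_span S Ss); last first.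
      by move=> v vs; apply/C1; exists s' => //; apply: pos_mem.
    by apply: memvB; apply: memv_span; rewrite !inE eqxx ?orbT.
  by have [cs H] := to_columns ell_e phi_e Sz sumz; exists cs => _; rewrite zE in H.
have {colsP}[cs csP] := choice colsP.
pose L := flatten [seq cs s' | s' <- l].
have wL K : K \in L -> wf ell phi m K.
  by case/flatten_mapP => s' sl; apply: (csP s' sl).1.
have eL : eqv l (map (colx e) L).
  rewrite -[l in eqv l _](flatten_seq1 l) map_flatten -map_comp.
  by apply: eqv_flatten => s' /csP[].
have [_ NL CL] := (eqv_tri ell m.+1 (pos s) eL).1 T.
have posT x : pos s x <-> pos (colx e KT) x.
  by split; apply: pos_perm => //; rewrite perm_sym.
(* Both graphs of [K] over [u] consist of points of [s]; reading these points in the column [KT]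
   gives the three bounds. *)
have sub K u : K \in L -> pos (base K) u -> [/\ pos (base KT) u,
    ev (low KT) u <= ev (low K) u & ev (high K) u <= ev (high KT) u].
  move=> KL pu; have wK := wL K KL; have [_ hK _ _] := wK.
  have u0 : ev phi u = 0 by apply: span_vanish hK (pos_span pu).
  have le : ev (low K) u <= ev (high K) u.
    rewrite -subr_ge0 -ev_subf; apply: pos_ge0 pu => v /(wf_below wK).
    by rewrite ev_subf subr_ge0.
  have inT h : ev (low K) u <= ev h u -> ev h u <= ev (high K) u -> [/\ pos (base KT) u,
      ev (low KT) u <= ev h u & ev h u <= ev (high KT) u].
    move=> l1 l2; have : pos (colx e KT) (lift e h u).
      apply/posT/CL; exists (colx e K); first exact: map_f.
      exact: col_in wK pu l1 l2.
    by move=> /(col_out phi_e wT); rewrite proj_lift // phi_lift.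
  by have [p1 p2 _] := inT _ (lexx _) le; have [_ _ p3] := inT _ le (lexx _).
have [hs hsP] := choice (@pos_halfspaces R W).
pose HS := [:: low KT, high KT & map (@low R W) L ++ map (@high R W) L].
pose fs := flatten [seq hs (base K) | K <- L] ++ [seq h - k | h <- HS, k <- HS].
have [ST horT _ _] := wT.
have [gam [eg Dg _] Ug] := cut_functionals fs ST.
have Tg := (eqv_tri ell m (pos (base KT)) eg).1 (tri1 ST).
have Sg g : g \in gam -> simp ell m g by case/Dg.
have UH g : g \in gam -> forall h k, h \in HS -> k \in HS -> uncut (h - k) g.
  move=> gg h k hH kH; apply: Ug gg _; rewrite mem_cat; apply/orP; right.
  by apply/allpairsP; exists (h, k).
have UB g K : g \in gam -> K \in L -> forall f, f \in hs (base K) -> uncut f g.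
  move=> gg KL f fK; apply: Ug gg _; rewrite mem_cat; apply/orP; left.
  by apply/flatten_mapP; exists K.
have freeK K : K \in L -> free (base K) by move=> /wL[/simp_free].
pose st K g := stair e (low K) (high K) [::] g.
have eK K : K \in L ->
    eqv [:: colx e K] (flatten [seq st K g | g <- gam & insideb g (base K)]).
  move=> KL; have wK := wL K KL; have [SK _ _ _] := wK.
  have E : eqv [:: base K] [seq g <- gam | insideb g (base K)].
    apply: eqv_sym; apply: IH => //; apply: tri_inside Tg SK _ _.
      by move=> x /(sub K x KL)[].
    move=> g gg; apply: inside_ov (hsP _ (freeK K KL)) (Sg g gg) _.
    exact: UB.
  have bel s' : s' \in [:: base K] -> below s' (low K) (high K).
    by rewrite inE => /eqP->; apply: wf_below wK.
  apply: eqv_trans _ (eqv_stair e E bel).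
  by rewrite -(stair_col e wK) [X in eqv _ X]cats0.
have eT : eqv [:: s] (flatten [seq st KT g | g <- gam]).
  apply: eqv_trans (eqv_vertices _ pT) _.
  have bel s' : s' \in [:: base KT] -> below s' (low KT) (high KT).
    by rewrite inE => /eqP->; apply: wf_below wT.
  apply: eqv_trans _ (eqv_stair e eg bel).
  by rewrite -(stair_col e wT) [X in eqv _ X]cats0.
apply: eqv_trans eL (eqv_trans _ (eqv_sym eT)).
rewrite -[X in eqv X _](flatten_seq1) -map_comp.
apply: eqv_trans (eqv_flatten eK) _.
apply: eqv_trans (eqv_perm (perm_flatten_exchange (fun K g => insideb g (base K)) st L gam)) _.
apply: eqv_flatten => g gg; have Sgg := Sg g gg.
have [ig pc] : inside g (base KT) /\ pos (base KT) (bary g).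
  by have [_ i] := Dg g gg; split=> //; apply: pos_sub (pos_bary g).
have c0 : ev phi (bary g) = 0 by apply: span_vanish horT (pos_span pc).
have HL K : K \in L -> low K \in HS /\ high K \in HS.
  by move=> KL; rewrite !inE !mem_cat !map_f ?orbT.
apply: (@stair_stack _ _ e _ (@low R W) (@high R W) _ _ _ (fun h => h \in HS)).
- exact: UH.
- by rewrite mem_head.
- by rewrite !inE eqxx orbT.
- move=> K; rewrite mem_filter => /andP[/asboolP i KL]; have [HL1 HL2] := HL K KL.
  have pK : pos (base K) (bary g) by apply: pos_sub (pos_bary g).
  have [_ le1 le2] := sub K _ KL pK; split=> //.
  exact: wf_lt (wL K KL) Sgg i.
- exact/ltW/(wf_lt wT Sgg ig).
- move=> K1 K2 D' p; have /and3P[] : [&& K1 \in [seq K <- L | insideb g (base K)],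
      K2 \in [seq K <- L | insideb g (base K)] & true].
    by rewrite !(perm_mem p) !inE !eqxx !orbT.
  rewrite !mem_filter => /andP[/asboolP i1 KL1] /andP[/asboolP i2 KL2] _.
  have [L1 H1] := HL K1 KL1; have [L2 H2] := HL K2 KL2.
  apply: (@layers_ordered e phi ell_e phi_e m g K1 K2 (fun h => h \in HS) (UH g gg)
    L1 L2 H1 H2 Sgg (wL K1 KL1) (wL K2 KL2) i1 i2).
  have pL : perm_eq L [:: K1, K2 & D' ++ [seq K <- L | ~~ insideb g (base K)]].
    rewrite -(perm_filterC (fun K => insideb g (base K)) L) perm_sym.
    by rewrite -[[:: K1, K2 & _]]/([:: K1, K2 & D'] ++ _) perm_cat2r perm_sym.
  exact: (NL _ _ (map (colx e) _) (perm_map (colx e) pL)).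
- move=> eta le1 le2.
  (* The point of [s] over the barycenter at height [eta] lies in some column [K]. The base of [K]
     then contains the barycenter, hence all of [g], since [g] is uncut by its facets. *)
  have /posT/CL[x /mapP[K KL ->] px] : pos (colx e KT) (bary g + eta *: e).
    by apply: col_in wT pc _ _; apply: ltW.
  have [] := col_out phi_e (wL K KL) px.
  have -> : proj e phi (bary g + eta *: e) = bary g.
    by rewrite /proj evD evZ c0 phi_e add0r mulr1 addrK.
  rewrite evD evZ c0 phi_e add0r mulr1 => pK l1 l2.
  exists K; last by rewrite l1.
  rewrite mem_filter KL andbT; apply/asboolP.
  by apply: (inside_bary (hsP _ (freeK K KL))) pK => f; apply: UB.
Qed.

Lemma tile_simplex m s l : simp ell m.+1 s -> tri ell m.+1 l (pos s) -> eqv l [:: s].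
Proof.
elim: m s l => [|m IH] [|s0 s] l S T; try by case: S.
  case: s S T => [|s1 s] S T; last by case: S.
  have [_ _ el] := S; have [S1 N1 C1] := T.
  (* Dimension 0: the ray through [s0] has one point at height 1. Covering then gives at least one
     member and non-overlap at most one. *)
  have one s' : s' \in l -> s' = [:: s0].
    move=> sl; have [_ sz el'] := S1 s' sl.
    case: s' sl sz el' => [|v [|? ?]] // sl _ el'.
    have /pos_cons[a [y [a0 py vE]]] : pos [:: s0] v.
      by apply/C1; exists [:: v] => //; apply: pos_mem; rewrite mem_head.
    have y0 : y = 0 by case: py => // u b x; rewrite in_nil.
    have := el' v (mem_head _ _); rewrite vE y0 addr0 evZ el ?mem_head // mulr1 => ->.
    by rewrite scale1r.
  have [s' sl _] : exists2 s', s' \in l & pos s' s0.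
    by apply/C1; apply: pos_mem; rewrite mem_head.
  case: l one sl {T} S1 N1 C1 => [|a [|b l]] // one _ S1 N1 _.
    by rewrite (one a) ?mem_head.
  case: (N1 a b l) => //; rewrite (one a) ?mem_head // (one b) ?inE ?eqxx ?orbT //.
  exact: simp_ov.
case: s S T => [|s1 s] S T; first by case: S.
exact: tile_step IH S T.
Qed.

End TileStep.

(** * Triangulations of polyhedra *)

Local Open Scope classical_set_scope.

Section Homogenization.
Context {R : realType} {N : nat}.
Let W : vectType R := ('rV[R]_N * R^o)%type.
Implicit Types (s r : seq W) (l : seq (seq W)) (x z : 'rV[R]_N).

Definition hom x : W := (x, 1).

Definition ell : 'Hom(W, R^o) := linfun (@snd _ _ : W -> R^o).

Lemma ellE (v : W) : ev ell v = v.2.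
Proof. by rewrite /ev lfunE. Qed.

Lemma ell_hom x : ev ell (hom x) = 1.
Proof. by rewrite ellE. Qed.

Lemma homK (v : W) : ev ell v = 1 -> hom v.1 = v.
Proof. by rewrite ellE; case: v => x c /= ->. Qed.

Lemma hom_comb (I : finType) (w : I -> R) (p : I -> 'rV[R]_N) : \sum_i w i = 1 ->
  hom (\sum_i w i *: p i) = \sum_i w i *: hom (p i).
Proof.
move=> w1; have E1 : (\sum_i w i *: hom (p i)).1 = \sum_i w i *: p i.
  by elim/big_rec2: _ => //= i y1 y2 _ <-.
have E2 : (\sum_i w i *: hom (p i)).2 = 1.
  rewrite -[RHS]w1; elim/big_rec2: _ => //= i y1 y2 _ <-.
  by congr (_ + _); apply: mulr1.
by rewrite /hom -E1 -[X in (_, X)]E2; case: (\sum_i _).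
Qed.

Lemma hom_combE (I : finType) (w : I -> R) (p : I -> 'rV[R]_N) x :
  hom x = \sum_i w i *: hom (p i) -> \sum_i w i = 1 /\ x = \sum_i w i *: p i.
Proof.
move=> E; have w1 : \sum_i w i = 1.
  have := congr1 (ev ell) E; rewrite ell_hom ev_sum => ->.
  by apply: eq_bigr => i _; rewrite evZ ell_hom mulr1.
by split=> //; move: E; rewrite -hom_comb // => -[].
Qed.

Definition hull s : set 'rV[R]_N := [set x | pos s (hom x)].

Definition points k (p : 'I_k -> 'rV[R]_N) : seq W := [seq hom (p i) | i <- enum 'I_k].

Lemma mem_points k (p : 'I_k -> 'rV[R]_N) i : hom (p i) \in points p.
Proof. by apply: map_f; rewrite mem_enum. Qed.

Lemma pos_points k (p : 'I_k -> 'rV[R]_N) (v : W) : pos (points p) v ->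
  exists2 c : 'I_k -> R, (forall i, 0 <= c i) & v = \sum_i c i *: hom (p i).
Proof.
elim=> [|u a y /mapP[i _ ->] a0 _ [c c0 ->]].
  by exists (fun=> 0) => //; rewrite big1 // => i _; rewrite scale0r.
exists (fun j => c j + a * (j == i)%:R) => [j|].
  by rewrite addr_ge0 // mulr_ge0.
under [RHS]eq_bigr => j _ do rewrite scalerDl.
rewrite big_split addrC /=; congr (_ + _).
rewrite (bigD1 i) //= eqxx mulr1 big1 ?addr0 // => j /negbTE->.
by rewrite mulr0 scale0r.
Qed.

Lemma convex_hull_points k (p : 'I_k -> 'rV[R]_N) : convex_hull (range p) = hull (points p).
Proof.
apply/seteqP; split=> x.
  move=> [k' [q [w [qp w0 w1 ->]]]]; rewrite /hull /= hom_comb //.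
  elim/big_rec: _ => [|i y _ py]; first exact: pos0.
  apply: pos_step => //; have [j _ <-] := qp i; exact: mem_points.
move=> /pos_points[c c0 /hom_combE[c1 ->]].
by exists k, p, c; split=> // i; exists i.
Qed.

Lemma free_points k (p : 'I_k -> 'rV[R]_N) : affinely_independent p <-> free (points p).
Proof.
have -> : points p = [tuple hom (p i) | i < k] by [].
have nthE (i : 'I_k) : [tuple hom (p i) | i < k]`_i = hom (p i).
  by rewrite -tnth_nth tnth_mktuple.
split=> [H|/freeP H w w0 wp].
  apply/freeP => c; under eq_bigr => i _ do rewrite nthE.
  move=> E; apply: H.
    have := congr1 (ev ell) E; rewrite ev_sum ev0 => {2}<-.
    by apply: eq_bigr => i _; rewrite evZ ell_hom mulr1.
  have := congr1 fst E; rewrite [X in _ = X]/= => {2}<-.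
  by elim/big_rec2: _ => //= i y1 y2 _ ->.
apply: H; under eq_bigr => i _ do rewrite nthE.
suff [E1 E2] : (\sum_i w i *: hom (p i)).1 = 0 /\ (\sum_i w i *: hom (p i)).2 = 0.
  by rewrite [LHS]surjective_pairing E1 E2.
split; first by rewrite -[RHS]wp; elim/big_rec2: _ => //= i y1 y2 _ <-.
by rewrite -ellE ev_sum -[RHS]w0; apply: eq_bigr => i _; rewrite evZ ell_hom mulr1.
Qed.

Lemma simp_points n (p : 'I_n.+1 -> 'rV[R]_N) :
  affinely_independent p -> simp ell n.+1 (points p).
Proof.
move=> /free_points f; split=> //; first by rewrite size_map size_enum_ord.
by move=> v /mapP[i _ ->]; apply: ell_hom.
Qed.

Lemma simp_vertices n s : simp ell n.+1 s ->
  exists p : 'I_n.+1 -> 'rV[R]_N, [/\ s = points p, affinely_independent p &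
    forall i, hom (p i) = s`_i].
Proof.
move=> [f sz el]; pose p (i : 'I_n.+1) := (s`_i).1.
have pE i : hom (p i) = s`_i by apply: homK; apply: el; rewrite mem_nth // sz.
have sE : s = points p.
  apply: (@eq_from_nth _ 0); first by rewrite size_map size_enum_ord sz.
  rewrite sz => i lt; rewrite (nth_map ord0) ?size_enum_ord //.
  by rewrite pE nth_enum_ord.
by exists p; split=> //; apply/free_points; rewrite -sE.
Qed.

Lemma simplexP n (T : set 'rV[R]_N) :
  simplex n T <-> exists2 s, simp ell n.+1 s & T = hull s.
Proof.
split=> [[p [ai ->]]|[s S ->]].
  by exists (points p); [apply: simp_points|apply: convex_hull_points].
have [p [-> ai _]] := simp_vertices S.
by exists p; split=> //; rewrite convex_hull_points.
Qed.

Lemma hull_sub s1 s2 :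
  (forall v, v \in s1 -> ev ell v = 1) -> hull s1 `<=` hull s2 -> inside s1 s2.
Proof.
move=> el H v vs; rewrite -(homK (el v vs)); apply: H.
by rewrite /hull /= homK ?el //; apply: pos_mem.
Qed.

Definition dir0 (x : 'rV[R]_N) : W := (x, 0).

Lemma dir0_linear : linear dir0.
Proof.
move=> a x y; apply: injective_projections => //=.
by rewrite -[RHS]/(a * 0 + 0) mulr0 addr0.
Qed.

HB.instance Definition _ := GRing.isLinear.Build R 'rV[R]_N W *:%R dir0 dir0_linear.

Definition dir : 'Hom('rV[R]_N, W) := linfun dir0.

Lemma dirE x : dir x = (x, 0).
Proof. by rewrite lfunE. Qed.

Lemma homB x z : hom x - hom z = dir (x - z).
Proof. by rewrite dirE; apply: injective_projections => //=; apply: subrr. Qed.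

Lemma dir_inj (U : {vspace 'rV[R]_N}) : \dim (dir @: U) = \dim U.
Proof.
apply: limg_dim_eq; apply/eqP; rewrite -subv0; apply/subvP => x.
by rewrite memv_cap memv_ker dirE => /andP[_ /eqP[->]]; apply: mem0v.
Qed.

(** The directions of an affine space at height 1 are the vectors of its span killed by [ell]: this
    is the shift by one between affine and linear dimension. *)
Lemma dim_ker_ell (D : {vspace W}) v : v \in D -> ev ell v = 1 ->
  (\dim (D :&: lker ell)).+1 = \dim D.
Proof.
move=> vD v1; rewrite -(limg_ker_dim ell D) addnC -add1n; congr (_ + _)%N.
apply/eqP; rewrite eqn_leq; apply/andP; split.
  rewrite lt0n dimv_eq0; apply/eqP => E.
  have : ell v \in (ell @: D)%VS by apply: memv_img.
  by rewrite E memv0 -[ell v]/(ev ell v) v1 oner_eq0.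
by apply: leq_trans (dimvS (subvf _)) _; rewrite dimvf.
Qed.

Lemma max_free (Q : W -> Prop) :
  exists r, [/\ free r, forall v, v \in r -> Q v & forall v, Q v -> v \in <<r>>%VS].
Proof.
suff main k : forall r, free r -> (forall v, v \in r -> Q v) ->
    (\dim (fullv : {vspace W}) - size r < k)%N ->
    exists r', [/\ free r', forall v, v \in r' -> Q v & forall v, Q v -> v \in <<r'>>%VS].
  by apply: (main _ [::]) => //; apply: nil_free.
elim: k => // k IH r fr Qr lt.
have [H|] := pselect (forall v, Q v -> v \in <<r>>%VS); first by exists r.
move=> /existsNP[v /not_implyP[Qv /negP nv]].
have fv : free (v :: r) by rewrite free_cons nv.
apply: (IH (v :: r)) => //.
  by move=> u; rewrite inE => /predU1P[->|/Qr].
have : (size (v :: r) <= \dim (fullv : {vspace W}))%N.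
  by move: (fv); rewrite /free => /eqP<-; apply/dimvS/subvf.
by move: lt => /=; lia.
Qed.

Lemma affine_hull_span (A : set 'rV[R]_N) (D : {vspace W}) x :
  (forall y, A y -> hom y \in D) -> affine_hull A x -> hom x \in D.
Proof.
move=> AD [k [p [w [Ap w1 ->]]]]; rewrite hom_comb //.
by apply: memv_suml => i _; apply: memvZ; apply: AD.
Qed.

Lemma span_affine_hull (A : set 'rV[R]_N) r x :
    (forall v, v \in r -> ev ell v = 1) -> (forall v, v \in r -> A v.1) -> free r ->
  hom x \in <<r>>%VS -> affine_hull A x.
Proof.
move=> el rA fr /(span_bdual fr); rewrite (big_nth 0) big_mkord => E.
exists (size r), (fun i => (r`_i).1), (fun i => ev (bdual r r`_i) (hom x)).
have [w1 xE] : \sum_(i < size r) ev (bdual r r`_i) (hom x) = 1 /\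
    x = \sum_(i < size r) ev (bdual r r`_i) (hom x) *: (r`_i).1.
  apply: hom_combE; rewrite {1}E; apply: eq_bigr => i _.
  by rewrite homK // el // mem_nth.
by split=> // i; apply: rA; apply: mem_nth.
Qed.

(** From left to right, a maximal free family of points of the intersection is long enough. From
    right to left, a common full-size family spans the same space as the cones, so its affine hull
    is that of the intersection. *)
Lemma has_dim_ov n s1 s2 : simp ell n.+1 s1 -> simp ell n.+1 s2 ->
  has_dim n (hull s1 `&` hull s2) <-> ov ell n.+1 s1 s2.
Proof.
move=> S1 S2; set A := _ `&` _; split.
  move=> [x0 [U [dU AU]]].
  have [r [fr Qr Dr]] := max_free (fun v => exists2 x, A x & v = hom x).
  have AD y : A y -> hom y \in <<r>>%VS by move=> Ay; apply: Dr; exists y.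
  have h0 : hom x0 \in <<r>>%VS.
    by apply: affine_hull_span AD _; rewrite AU /= subrr mem0v.
  have le : (n < size r)%N.
    have <- : \dim <<r>>%VS = size r by apply/eqP.
    rewrite -(dim_ker_ell h0 (ell_hom _)) -dU -dir_inj ltnS; apply: dimvS.
    apply/subvP => _ /memv_imgP[u uU ->]; rewrite memv_cap; apply/andP; split.
      have -> : dir u = hom (x0 + u) - hom x0 by rewrite homB addrC addKr.
      apply: memvB h0; apply: affine_hull_span AD _.
      by rewrite AU /= addrC addKr.
    by rewrite memv_ker -[ell _]/(ev ell (dir u)) ellE dirE.
  (* Only a lower bound on the size of [r] is known, so it is truncated to the size that [simp]
     demands. *)
  exists (take n.+1 r).
    split; first by move: fr; rewrite -{1}(cat_take_drop n.+1 r) => /catl_free.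
      by rewrite size_takel.
    by move=> v /mem_take/Qr[x _ ->]; apply: ell_hom.
  by move=> v /mem_take/Qr[x [? ?] ->].
move=> [r Sr P]; have [fr szr el] := Sr.
have [p [rE ai pE]] := simp_vertices Sr.
pose D := <<r>>%VS; exists (p ord0), (dir @^-1: D)%VS.
have pD i : hom (p i) \in D by apply: memv_span; rewrite rE mem_points.
split; last first.
  apply/seteqP; split=> x.
    move=> H; rewrite /= -memv_preim -homB; apply: memvB => //.
    apply: affine_hull_span H => y [/pos_span y1 _].
    rewrite /D (simp_span S1 Sr) //; by move=> v /P[].
  rewrite /= -memv_preim -homB => H; apply: (span_affine_hull el _ fr).
    by move=> v vr; have [? ?] := P v vr; split; rewrite /hull /= homK // el.
  by rewrite -(subrK (hom (p ord0)) (hom x)); apply: memvD.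
rewrite -dir_inj; apply: succn_inj; rewrite -szr.
have -> : size r = \dim D by apply/esym/eqP.
rewrite -(dim_ker_ell (pD ord0) (ell_hom _)); congr (\dim _).+1.
apply/eqP; rewrite eqEsubv; apply/andP; split; apply/subvP => v.
  move=> /memv_imgP[u]; rewrite -memv_preim => uD ->; rewrite memv_cap uD /=.
  by rewrite memv_ker -[ell _]/(ev ell (dir u)) ellE dirE.
rewrite memv_cap memv_ker => /andP[vD /eqP v0].
have E : v = dir v.1.
  by rewrite dirE; apply: injective_projections => //=; rewrite -ellE.
by rewrite E; apply: memv_img; rewrite -memv_preim -E.
Qed.

(** * From lists of cones to triangulations and back *)

Definition hulls l : set (set 'rV[R]_N) := [set T | exists2 s, s \in l & T = hull s].

Definition cone (P : set 'rV[R]_N) (v : W) : Prop :=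
  exists (c : R) x, [/\ 0 <= c, P x & v = c *: hom x].

Lemma cone_hom P x : cone P (hom x) <-> P x.
Proof.
split=> [[c [z [_ Pz E]]]|Px]; last by exists 1, x; rewrite scale1r.
have c1 : c = 1 by have := congr1 (ev ell) E; rewrite evZ !ell_hom mulr1.
by move: E; rewrite c1 scale1r => -[->].
Qed.

Lemma pos_cone m s P v : simp ell m.+1 s -> hull s `<=` P -> pos s v -> cone P v.
Proof.
move=> [_ sz el] sP pv.
have [c0 cv] : 0 <= ev ell v /\ (ev ell v = 0 -> v = 0).
  elim: pv => [|u a y us a0 _ [y0 yE]]; first by rewrite ev0.
  rewrite evD evZ el // mulr1; split=> [|E]; first exact: addr_ge0.
  have a1 : a = 0 by lra.
  by rewrite a1 yE ?scale0r ?addr0 //; lra.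
(* The apex belongs to [cone P] only if [P] has a point; the first vertex of [s] provides one. *)
have [v0|n0] := eqVneq (ev ell v) 0.
  have us : s`_0 \in s by rewrite mem_nth // sz.
  exists 0, (s`_0).1; rewrite scale0r cv //; split=> //.
  by apply: sP; rewrite /hull /= homK ?el //; apply: pos_mem.
have vE : v = ev ell v *: hom ((ev ell v)^-1 *: v.1).
  apply: injective_projections; first by rewrite /= scalerA mulfV // scale1r.
  by rewrite -[LHS]ellE -[RHS]/(ev ell v * 1) mulr1.
exists (ev ell v), ((ev ell v)^-1 *: v.1); split=> //.
apply: sP; rewrite /hull /=.
rewrite -[hom _]scale1r -(mulVf n0) -scalerA -vE.
by apply: posZ => //; rewrite invr_ge0.
Qed.

Lemma hull_ov n s1 s2 : simp ell n s1 -> hull s1 = hull s2 -> ov ell n s1 s2.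
Proof.
move=> S E; exists s1 => // v vs; split; first exact: pos_mem.
have [_ _ el] := S; have i : inside s1 s2 by apply: hull_sub; rewrite // E.
exact: i.
Qed.

Lemma tri_cone n l P : (forall s, s \in l -> simp ell n.+1 s) -> nonov ell n.+1 l ->
  \bigcup_(T in hulls l) T = P -> tri ell n.+1 l (cone P).
Proof.
move=> S NO <-; split=> // v; split=> [[c [x [c0 [_ [s sl ->] sx] ->]]]|[s sl]].
  by exists s => //; apply: posZ.
apply: pos_cone (S s sl) _ => x sx; exists (hull s) => //; by exists s.
Qed.

Lemma tri_triangulation n l P : tri ell n.+1 l (cone P) -> triangulation n P (hulls l).
Proof.
move=> [S NO C]; split.
- have -> : hulls l = hull @` [set` l].
    by apply/seteqP; split=> T [s sl]; [move=> ->|move=> <-]; exists s.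
  exact: finite_image.
- by move=> _ [s sl ->]; apply/simplexP; exists s => //; apply: S.
- move=> _ _ [s1 s1l ->] [s2 s2l ->] ne /(has_dim_ov (S _ s1l) (S _ s2l)).
  by move=> /(nonov_eq NO s1l s2l) E; apply: ne; rewrite E.
- apply/seteqP; split=> x.
    by move=> [_ [s sl ->] sx]; apply/cone_hom/C; exists s.
  by move=> /cone_hom/C[s sl sx]; exists (hull s) => //; exists s.
Qed.

Lemma triangulation_tri n P a : triangulation n P a ->
  exists2 l, a = hulls l & tri ell n.+1 l (cone P).
Proof.
move=> [/finite_seqP[A aE] simpA dimA cov].
have vert T : exists s, a T -> simp ell n.+1 s /\ T = hull s.
  have [aT|] := pselect (a T); last by exists [::].
  by have [s S ->] := (simplexP n T).1 (simpA T aT); exists s.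
have [V VP] := choice vert.
have Aa T : T \in undup A -> a T by rewrite mem_undup aE.
(* Duplicates are removed since [nonov] forbids them; [V] creates none, as [T] is recovered as the
   hull of [V T]. *)
pose l := map V (undup A).
have lE : a = hulls l.
  apply/seteqP; split=> T.
    move=> aT; have [_ TE] := VP T aT; exists (V T) => //.
    by apply: map_f; rewrite mem_undup; move: aT; rewrite aE.
  by move=> [_ /mapP[T' /Aa aT' ->] ->]; have [_ <-] := VP T' aT'.
exists l => //; apply: tri_cone; last by rewrite -lE.
  by move=> _ /mapP[T /Aa aT ->]; have [] := VP T aT.
have ul : uniq l.
  rewrite map_inj_in_uniq ?undup_uniq // => T1 T2 /Aa a1 /Aa a2 E.
  by have [_ ->] := VP T1 a1; have [_ ->] := VP T2 a2; rewrite E.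
move=> s1 s2 l' p; have : uniq [:: s1, s2 & l'] by rewrite -(perm_uniq p).
rewrite /= inE negb_or => /andP[/andP[/eqP ne _] _].
have /mapP[T1 /Aa a1 E1] : s1 \in l by rewrite (perm_mem p) mem_head.
have /mapP[T2 /Aa a2 E2] : s2 \in l by rewrite (perm_mem p) !inE eqxx orbT.
have [S1 T1E] := VP T1 a1; have [S2 T2E] := VP T2 a2; rewrite -E1 -E2 in S1 T1E S2 T2E.
move=> O; apply: (dimA T1 T2 a1 a2) => [T12|]; first by apply: ne; rewrite E1 E2 T12.
by rewrite T1E T2E; apply/has_dim_ov.
Qed.

Lemma dissection_split n (x y w : W) (G : seq W) (t : R) : simp ell n.+2 [:: x, y & G] ->
    0 < t -> t < 1 -> w = (1 - t) *: x + t *: y ->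
  dissection n.+1 (hull [:: x, y & G]) (hull [:: w, y & G]) (hull [:: x, w & G]).
Proof.
move=> S t0 t1 wE; have [fr sz el] := S.
have [f [fG fw fx fy]] := split_functional fr t0 t1 wE.
have [S1 S2] := simp_split t0 t1 wE S.
(* On points at height 1 the form [f] is affine: [u] holds its values on the basis directions and
   [- c] its value at the origin, so [dot u z = c] is the wall. *)
pose u : 'rV[R]_N := \row_i ev f (dir (delta_mx 0 i)).
pose c : R := - ev f (hom 0).
have uE z : dot u z = ev f (hom z) + c.
  rewrite /c -evB homB subr0 {2}(row_sum_delta z) linear_sum ev_sum.
  by apply: eq_bigr => i _; rewrite mxE linearZ evZ mulrC.
have ex : hom x.1 = x by apply/homK/el; rewrite mem_head.
have ey : hom y.1 = y by apply/homK/el; rewrite !inE eqxx orbT.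
have sides z : hull [:: x, y & G] z ->
    (hull [:: w, y & G] z <-> dot u z <= c) /\ (hull [:: x, w & G] z <-> c <= dot u z).
  move=> /(pos_split_ge t0 t1 wE fG fw fx)[Ge Le]; rewrite uE.
  split; split.
  - move=> H; suff : ev f (hom z) <= 0 by lra.
    by apply: pos_le0 H => v; rewrite !inE => /or3P[/eqP->|/eqP->|/fG->] //; rewrite ?fw // ltW.
  - by move=> H; apply: Le; lra.
  - move=> H; suff : 0 <= ev f (hom z) by lra.
    by apply: pos_ge0 H => v; rewrite !inE => /or3P[/eqP->|/eqP->|/fG->] //; rewrite ?fw // ltW.
  - by move=> H; apply: Ge; lra.
have sub z : hull [:: w, y & G] z \/ hull [:: x, w & G] z -> hull [:: x, y & G] z.
  exact: pos_split_sub t0 t1 wE.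
exists u, c; split.
- apply/eqP => u0; have d0 z : dot u z = 0.
    by rewrite /dot big1 // => i _; rewrite u0 mxE mul0r.
  have := d0 x.1; have := d0 y.1; rewrite !uE ex ey; lra.
- move=> H; have /H : hull [:: x, y & G] x.1.
    by rewrite /hull /= ex; apply: pos_mem; rewrite mem_head.
  by rewrite /hyperplane /= uE ex; lra.
- have [p [sE ai pE]] := simp_vertices S.
  (* The vertices numbered 0 and 1 are [x] and [y]; the remaining [n] indices select the face
     spanned by [G]. *)
  pose J : {set 'I_n.+2} := [set rshift 2 j | j : 'I_n].
  exists (convex_hull (p @` [set` J])); split.
    exists p, J; split=> //; first by split=> //; rewrite convex_hull_points sE.
    by rewrite card_imset ?card_ord //; move=> j1 j2 E; apply: (@rshift_inj 2 n).
  move=> z [k [q [b [qJ b0 b1 ->]]]]; rewrite /hyperplane /= uE hom_comb // ev_sum.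
  rewrite big1 ?add0r // => i _; rewrite evZ.
  have [j /imsetP[j' _ ->] <-] := qJ i.
  rewrite pE /= fG ?mulr0 // mem_nth //.
  by case: sz => ->; rewrite add0n.
- split; apply/seteqP; split=> z.
  + by move=> H; have Hz := sub z (or_introl H); split=> //; apply/(sides z Hz).1.
  + by move=> [H1 H2]; apply/(sides z H1).1.
  + by move=> H; have Hz := sub z (or_intror H); split=> //; apply/(sides z Hz).2.
  + by move=> [H1 H2]; apply/(sides z H1).2.
- by split; apply/simplexP; [exact: ex_intro2 S1 erefl|exact: ex_intro2 S2 erefl].
Qed.

(** Both directions are carried together because [eqv] has a symmetry constructor while
    [move_equivalent] is a directed closure. *)
Lemma eqv_moves n l1 l2 P : (0 < n)%N -> eqv l1 l2 -> tri ell n.+1 l1 (cone P) ->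
  move_equivalent n P (hulls l1) (hulls l2) /\ move_equivalent n P (hulls l2) (hulls l1).
Proof.
move=> n0; elim=> {l1 l2}.
- move=> l1 l2 p _; have -> : hulls l1 = hulls l2; last by split; apply: rt_refl.
  by apply/seteqP; split=> T [s sl ->]; exists s => //; rewrite ?(perm_mem p) // -(perm_mem p).
- move=> s1 s2 l p _; have -> : hulls (s1 :: l) = hulls (s2 :: l); last by split; apply: rt_refl.
  have E : hull s1 = hull s2.
    by apply/seteqP; split=> x; apply: pos_perm => //; rewrite perm_sym.
  apply/seteqP; split=> T [s]; rewrite inE => /predU1P[->|sl] ->.
  + by exists s2; rewrite ?mem_head.
  + by exists s; rewrite // inE sl orbT.
  + by exists s1; rewrite ?mem_head.
  + by exists s; rewrite // inE sl orbT.
- move=> x y w G l t t0 t1 wE T1.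
  have T2 := (@tri_split R W ell n.+1 x y w G t l (cone P) t0 t1 wE).1 T1.
  case: n n0 T1 T2 => // n _ T1 T2.
  have [Sm1 /nonov_cons[N1 N1'] _] := T1; have [Sm2 /nonov_cons[N2 /nonov_cons[N3 _]] _] := T2.
  have S : simp ell n.+2 [:: x, y & G] by apply: Sm1; rewrite mem_head.
  have [S1 S2] := simp_split t0 t1 wE S.
  set T := hull [:: x, y & G]; set A := hull [:: w, y & G]; set B := hull [:: x, w & G].
  (* Families are lists but triangulations are sets, so removing a simplex must not delete an equal
     member of the rest. Non-overlap rules this out, since equal hulls overlap. *)
  have nT : ~ hulls l T by move=> [s sl E]; apply: (N1 s sl); apply: hull_ov S E.
  have nA : ~ hulls l A.
    by move=> [s sl E]; apply: (N2 s); [rewrite inE sl orbT|apply: hull_ov S1 E].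
  have nB : ~ hulls l B by move=> [s sl E]; apply: (N3 s sl); apply: hull_ov S2 E.
  have AB : A <> B by move=> E; apply: (N2 [:: x, w & G]); [rewrite mem_head|apply: hull_ov S1 E].
  have hT s1 l' : hulls (s1 :: l') = hull s1 |` hulls l'.
    apply/seteqP; split=> T' [].
    + by move=> s; rewrite inE => /predU1P[->|sl] ->; [left|right; exists s].
    + by move=> ->; exists s1; rewrite ?mem_head.
    + by move=> [s sl ->]; exists s; rewrite // inE sl orbT.
  have TAB : A `|` B = T.
    apply/seteqP; split=> z; first exact: pos_split_sub t0 t1 wE.
    move=> Tz; have [f [fG fw fx fy]] := split_functional (simp_free S) t0 t1 wE.
    have [Ge Le] := pos_split_ge t0 t1 wE fG fw fx Tz.
    by case: (leP 0 (ev f (hom z))) => fz; [right; apply: Ge|left; apply: Le; apply: ltW].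
  have aT : hulls ([:: x, y & G] :: l) = T |` hulls l by rewrite hT.
  have aAB : hulls [:: [:: w, y & G], [:: x, w & G] & l] = A |` (B |` hulls l) by rewrite !hT.
  rewrite aT aAB; split; apply: rt_step; split.
  + by rewrite -aT; apply: tri_triangulation.
  + left; exists T, A, B; split; first by left.
      exact: dissection_split S t0 t1 wE.
    apply/seteqP; split=> Z /=.
      move=> [->|[->|lZ]]; [by right; left|by right; right|left; split; first by right].
      by move=> E; apply: nT; rewrite -E.
    by move=> [[[->|lZ]]|[]->] //; [right; right|left|right; left].
  + by rewrite -aAB; apply: tri_triangulation.
  + right; exists A, B; rewrite TAB; split=> //; first by left.
    * by right; left.
    * by apply/simplexP; exists [:: x, y & G].
    * apply/seteqP; split=> Z /=.
        move=> [->|lZ]; [by right|left; split; first by right; right].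
        by move=> [E|E]; [apply: nA|apply: nB]; rewrite -E.
      by move=> [[[->|[->|lZ]] H]| ->]; [case: H; left|case: H; right|right|left].
- move=> l1 l2 e IH T2; have [] := IH ((eqv_tri ell n.+1 (cone P) e).2 T2); by split.
- move=> l2 l1 l3 e12 IH1 _ IH2 T1; have [a b] := IH1 T1.
  have [c d] := IH2 ((eqv_tri ell n.+1 (cone P) e12).1 T1).
  by split; [apply: rt_trans a c|apply: rt_trans d b].
Qed.

End Homogenization.

Theorem theorem1 (R : realType) (N n : nat) (hn : (1 <= n)%N) (hnN : (n <= N)%N)
    (P : set 'rV[R]_N) (hP : polyhedron n P)
    (alphaP betaP : set (set 'rV[R]_N))
    (halpha : triangulation n P alphaP) (hbeta : triangulation n P betaP) :
  move_equivalent n P alphaP betaP.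
Proof.
have [l1 -> T1] := triangulation_tri halpha.
have [l2 -> T2] := triangulation_tri hbeta.
have [] // := eqv_moves hn _ T1 (l2 := l2).
exact: eqv_tilings (@tile_simplex _ _ _ n) T1 T2.
Qed.
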